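(* Let $\psi:\mathbb{R}^n\to\mathbb{R}^k$ be a polynomial mapping such that each coordinate is multilinear, has 0-1 coefficients, and has degree at most $d$ and multiplicity $t$. Then $$\mathrm{GW}\big(\psi(\{0,1\}^n)\big)\;\lesssim_d\; n\,t\,\sqrt{k\,n^{1-\frac{1}{\lceil d/2\rceil}}\,\log n}.$$
   Context: The Gaussian width of a point set $T\subseteq\mathbb{R}^k$ is $\mathrm{GW}(T)=\mathbb{E}\big[\sup_{x\in T}\langle x,g\rangle\big]$, where $g\sim N(0,I_k)$ is a standard Gaussian vector in $\mathbb{R}^k$. The coordinates of $\psi$ are the polynomials $\psi_1,\dots,\psi_k:\mathbb{R}^n\to\mathbb{R}$ with $\psi=(\psi_1,\dots,\psi_k)$. A polynomial is multilinear if every variable has exponent $0$ or $1$ in each of its monomials. A polynomial has multiplicity $t$ if each of its variables has a nonzero exponent in at most $t$ monomials in its support. Here $\psi(\{0,1\}^n)$ denotes the image of the $n$-dimensional Boolean hypercube under $\psi$, and $\lesssim_d$ denotes an upper bound up to a constant depending only on $d$.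
   Formalization: The formal theorem assumes n ≥ 2, since for n = 1 the bound is 0 (log 1 = 0) while ψ(x) = x has positive Gaussian width, and d ≥ 1, since the exponent 1 − 1/⌈d/2⌉ is undefined for d = 0. *)

(* Defs.v *)
From HB Require Import structures.
From mathcomp Require Import all_boot all_order all_algebra.
(* The notations of mpoly.v clash with those of MathComp-Analysis, and some of
   its names (Measure, isMeasure) would shadow them: it is imported first,
   without notations, and its constants are written qualified. *)
From mathcomp Require Import -(notations) mpoly.
From mathcomp Require Import all_classical all_reals all_analysis.

Set Implicit Arguments.
Unset Strict Implicit.
Unset Printing Implicit Defensive.

Import Order.TTheory GRing.Theory Num.Theory.
Import numFieldNormedType.Exports.

Local Open Scope classical_set_scope.
Local Open Scope ring_scope.

Section gaussian_width.
Variable R : realType.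

Let RT : measurableType _ := measurableTypeR R.

Definition cons_pair k (p : RT * k.-tuple RT) : k.+1.-tuple RT :=
  [tuple of p.1 :: p.2].

Lemma measurable_cons_pair k :
  measurable_fun [set: RT * k.-tuple RT] (@cons_pair k).
Proof. exact: measurable_cons. Qed.

HB.instance Definition _ k :=
  isMeasurableFun.Build _ _ _ _ (@cons_pair k) (@measurable_cons_pair k).

(* N(0, I_k) is the k-fold product of N(0, 1), carried by k-tuples: the library
   puts a product sigma-algebra on k.-tuple R, but none on 'rV[R]_k. *)
Fixpoint std_gaussian k : probability (k.-tuple RT) R :=
  if k is k'.+1
  then distribution (normal_prob (0 : R) 1 \x std_gaussian k')%E (@cons_pair k')
  else dirac [tuple].

(* The coordinates are independent standard normals; as boxes generate the
   sigma-algebra, this determines std_gaussian. *)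
Lemma std_gaussian_box k (A : 'I_k -> set RT) :
  (forall i, measurable (A i)) ->
  std_gaussian k [set g | forall i, A i (tnth g i)] =
  (\prod_(i < k) normal_prob (0 : R) 1 (A i))%E.
Proof.
elim: k A => [|k IH] A mA.
  rewrite big_ord0 /= diracE mem_set//.
  by case.
rewrite big_ord_recl /= /distribution /pushforward /=.
rewrite (_ : _ @^-1` _ = A ord0 `*`
    [set g : k.-tuple RT | forall i, A (lift ord0 i) (tnth g i)]); last first.
  apply/seteqP; split => [[x g] /= H|[x g] /= [H0 H] i].
    split; first by have := H ord0; rewrite tnth0.
    by move=> i; have := H (lift ord0 i); rewrite tnthS.
  by case: (unliftP ord0 i) => [j ->|->]; rewrite ?tnthS ?tnth0.
have mB : measurable
    [set g : k.-tuple RT | forall i, A (lift ord0 i) (tnth g i)].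
  rewrite (_ : [set _ | _] = \bigcap_(i in [set: 'I_k])
      ((fun g : k.-tuple RT => tnth g i) @^-1` A (lift ord0 i))).
    apply: fin_bigcap_measurable; first exact: finite_finset.
    move=> i _; rewrite -[X in measurable X]setTI.
    exact: measurable_tnth.
  by apply/seteqP; split => g /= H i; [move=> _; exact: H|exact: (H i I)].
rewrite product_measure1E//; congr *%E; exact: IH.
Qed.

Definition gaussian_width k (T : set 'rV[R]_k) : \bar R :=
  (\int[std_gaussian k]_g
     ereal_sup [set (\sum_(i < k) x 0 i * tnth g i)%:E | x in T])%E.

End gaussian_width.

Section polynomials.
Variables (R : realType) (n : nat).
Implicit Type p : mpoly.mpoly n R.

Definition multilinear p :=
  forall m : mpoly.multinom n, m \in mpoly.msupp p -> forall j, (m j <= 1)%N.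

Definition zero_one_coeffs p :=
  forall m : mpoly.multinom n, mpoly.mcoeff m p = 0 \/ mpoly.mcoeff m p = 1.

(* mpoly.msize is one more than the degree, and 0 for the zero polynomial. *)
Definition degree_le (d : nat) p := (mpoly.msize p <= d.+1)%N.

Definition has_multiplicity (t : nat) p :=
  forall j : 'I_n,
    (count (fun m : mpoly.multinom n => m j != 0%N) (mpoly.msupp p) <= t)%N.

Definition poly_map k (psi : 'I_k -> mpoly.mpoly n R) (x : 'rV[R]_n) :
    'rV[R]_k :=
  \row_i mpoly.meval (x 0) (psi i).

Definition boolean_cube : set 'rV[R]_n :=
  [set x | forall j, x 0 j = 0 \/ x 0 j = 1].

End polynomials.

Arguments boolean_cube R n : clear implicits.

(* Main.v *)
Require Import Defs.
From mathcomp Require Import all_boot all_order all_algebra.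
From mathcomp Require Import -(notations) mpoly.
From mathcomp Require Import all_classical all_reals all_analysis.
From mathcomp Require Import measurable_realfun.
From mathcomp Require Import ring lra.

Set Implicit Arguments.
Unset Strict Implicit.
Unset Printing Implicit Defensive.

Import Order.TTheory GRing.Theory Num.Theory.
Import numFieldNormedType.Exports.

Local Open Scope classical_set_scope.
Local Open Scope ring_scope.

(** The supremum of sum_i g_i psi_i(x) over the cube is bounded by the norm of
    one random symmetric matrix G = sum_i g_i A_i with fixed coefficients A_i,
    and the norm of G by a trace moment. Write r for the half of d rounded up.

    Decoupling. On the cube x_j = (1 + y_j)/2 with y_j a sign, and x_j is
    idempotent. A nonconstant monomial is therefore a product of 2r variables,
    repetitions allowed, hence an average, over the subsets S of the 2r
    positions, of products of 2r signs. Labelling the variables by their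
    position gives an alphabet V of nu = 2rn letters, and each psi_i becomes
    psi_i(0) plus an average of forms P_i(X) = sum_e X(u_e) X(v_e): here X is a
    sign function on V, u_e and v_e are r-tuples of letters, and a letter lies
    in at most t edges e ([monomial_average], [multilinear_edges]). The constant
    parts psi_i(0) contribute a centred Gaussian, which does not change the
    mean of the supremum.

    Kikuchi matrices. The forms P_i have degree 2r; they become quadratic on
    words F with rm letters arranged in r rows of length m, where
    m^r is about nu^(r-1). To X corresponds the sign vector
    w_X(F) = prod X(F p). Two words are linked by the edge e when the second
    comes from the first by replacing, in one slot of each row, u_e by v_e. The
    product of the two signs is then X(u_e) X(v_e), as the other letters occur
    twice. Summing over the links of e gives a multiple of P_i(X) in which every
    edge counts the same number of times, (m nu^(m-1))^r. A random word has on
    average O(t) links, because |E| (m/nu)^r <= t. This remains true when the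
    word is known to contain u_e, since at most O(t) edges share a letter with
    e. Markov's inequality then shows that at least half of the links of each
    edge join two words of degree O(t). Keeping only these links, and giving
    them weights at most 2 that restore the common count, yields a symmetric
    nonnegative matrix A_i with row sums O(t) and
    w_X^T A_i w_X = 2 (m nu^(m-1))^r P_i(X) ([kikuchi_matrix]).

    Trace moment. For q = 2^h, iterating the Cauchy-Schwarz inequality gives
    (w^T G w)^q <= |w|^(2q) tr G^q ([qform_exp_le_trace]). Expanding tr G^q
    over the words i_1 ... i_q produces E[g_(i_1) ... g_(i_q)], which is
    nonnegative, times tr(A_(i_1) ... A_(i_q)), which lies between 0 and
    N tau^q for N words and row sums at most tau. Hence
    E tr G^q <= N tau^q E (sum_i g_i)^q ([integral_sum_words_le]): because the
    entries are nonnegative and only the largest row sum matters, no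
    noncommutative Khintchine inequality is involved. As sum_i g_i has variance
    k, its q-th moment is at most (C k q)^(q/2). Taking q of order
    log N = r m log nu turns N^(1/q) into a constant, and the factor
    sqrt (k q) is of order sqrt (k n^(1-1/r) log n). The factor
    (nu/m)^r = O(n) comes from the normalisation N / (m nu^(m-1))^r. *)

(** * Integrals against the normal law *)

Section normal_integrals.
Variable R : realType.
Local Notation mu := (@lebesgue_measure R).
Local Notation nu := (normal_prob (0 : R) 1).
Local Open Scope ereal_scope.

(** The normal law is given by a density with respect to Lebesgue measure; this
    is the change of density for integrals of nonnegative functions. *)
Lemma ge0_integral_normal_prob (f : R -> \bar R) :
  measurable_fun [set: R] f -> (forall x, 0 <= f x) ->
  \int[nu]_x f x = \int[mu]_x (f x * (normal_pdf 0%R 1%R x)%:E).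
Proof.
move=> mf f0; have dom := normal_prob_dominates (0 : R)%R 1%R.
have mpdf : measurable_fun [set: R] (fun x => (normal_pdf (0 : R)%R 1%R x)%:E).
  by apply/measurable_EFinP; exact: measurable_normal_pdf.
rewrite -(Radon_Nikodym_SigmaFinite.change_of_variables dom)//.
apply: ae_eq_integral => //.
- apply: emeasurable_funM => //.
  exact: measurable_int (Radon_Nikodym_SigmaFinite.f_integrable dom).
- exact: emeasurable_funM.
- apply: ae_eqe_mul2l; apply: integral_ae_eq => //.
  + exact: Radon_Nikodym_SigmaFinite.f_integrable.
  + by move=> E _ mE; rewrite -Radon_Nikodym_SigmaFinite.f_integral.
Qed.

(** Completing the square turns e^(l x) times the density of N(0,1) into
    e^(l^2/2) times the density of N(l,1), whose integral is known to be 1. *)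
Lemma normal_mgf (l : R) :
  \int[nu]_x (expR (l * x))%:E = (expR (l ^+ 2 / 2))%:E.
Proof.
rewrite ge0_integral_normal_prob; last 2 first.
- by apply/measurable_EFinP; apply: measurableT_comp.
- by move=> x; rewrite lee_fin expR_ge0.
transitivity (\int[mu]_x ((expR (l ^+ 2 / 2))%:E * (normal_pdf l 1%R x)%:E)).
  apply: eq_integral => x _; rewrite -!EFinM; congr EFin.
  rewrite !normal_pdfE ?oner_eq0// /normal_fun !mulrA.
  rewrite [(expR _ * _)%R]mulrC [(expR (l ^+ 2 / 2) * _)%R]mulrC -!mulrA.
  by congr (_ * _)%R; rewrite -!expRD; congr expR; rewrite expr1n; field.
rewrite ge0_integralZl//; first by rewrite integral_normal_pdf mule1.
- by apply/measurable_EFinP; exact: measurable_normal_pdf.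
- by move=> x _; rewrite lee_fin normal_pdf_ge0.
Qed.

Lemma ge0_integral_normal_opp (f : R -> \bar R) :
  measurable_fun [set: R] f -> (forall x, 0 <= f x) ->
  \int[nu]_x f (- x)%R = \int[nu]_x f x.
Proof.
move=> mf f0.
have mN : measurable_fun [set: R] (fun x : R => - x)%R by exact: oppr_measurable.
have mfN : measurable_fun [set: R] (fun x => f (- x)%R).
  exact: measurableT_comp mf mN.
rewrite !ge0_integral_normal_prob//.
pose h x := f x * (normal_pdf 0%R 1%R x)%:E.
have h0 x : 0 <= h x by rewrite mule_ge0// lee_fin normal_pdf_ge0.
have mh : measurable_fun [set: R] h.
  apply: emeasurable_funM => //.
  by apply/measurable_EFinP; exact: measurable_normal_pdf.
transitivity (\int[mu]_(x in [set: R]) h (- x)%R).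
  apply: eq_integral => x _; rewrite /h; congr (_ * _%:E).
  by rewrite !normal_pdfE ?oner_neq0// /normal_fun !subr0 sqrrN.
rewrite -[LHS](@ge0_integral_pushforward _ _ (measurableTypeR R)
  (measurableTypeR R) R -%R mN mu setT h)//.
by apply: eq_measure_integral => A mA _; exact: lebesgue_measureN.
Qed.

End normal_integrals.

(** * Moments of standard Gaussian vectors *)

Section gaussian_moments.
Variable R : realType.
Local Notation RT := (measurableTypeR R).

(** The first coordinate can be integrated separately; the inductions on the
    dimension below rest on this. *)
Lemma std_gaussian_tonelli k (f : k.+1.-tuple RT -> \bar R) :
  measurable_fun [set: k.+1.-tuple RT] f -> (forall g, 0 <= f g)%E ->
  (\int[std_gaussian R k.+1]_g f g =
   \int[normal_prob (0 : R) 1]_x \int[std_gaussian R k]_g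
     f [tuple of x :: g])%E.
Proof.
move=> mf f0.
rewrite [LHS](@ge0_integral_distribution _ _ _ _ _
  (normal_prob (0 : R) 1 \x std_gaussian R k)%E (@cons_pair R k) f mf f0).
rewrite fubini_tonelli1//; last by move=> p; exact: f0.
exact: (measurableT_comp mf (@measurable_cons_pair R k)).
Qed.

(* Unfolding the recursion of std_gaussian on successors is left to the lemma
   above, as automatic simplification would otherwise do it everywhere. *)
Local Opaque std_gaussian.

Lemma measurable_cons1 k (x : R) :
  measurable_fun [set: k.-tuple RT]
    (fun g : k.-tuple RT => [tuple of x :: g] : k.+1.-tuple RT).
Proof. exact: measurable_cons. Qed.

Lemma measurable_tnth_comp k (h : R -> R) (i : 'I_k) :
  measurable_fun [set: R] h ->
  measurable_fun [set: k.-tuple RT] (fun g : k.-tuple RT => h (tnth g i)).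
Proof. by move=> mh; apply: measurableT_comp => //; exact: measurable_tnth. Qed.

Lemma ge0_integral_std_gaussian_prod k (h : R -> R) (c : R) :
  measurable_fun [set: R] h -> (forall x, 0 <= h x) ->
  (\int[normal_prob (0 : R) 1]_x (h x)%:E = c%:E)%E ->
  (\int[std_gaussian R k]_g (\prod_(i < k) h (tnth g i))%:E = (c ^+ k)%:E)%E.
Proof.
move=> mh h0 hc; elim: k => [|k IH].
  under eq_integral do rewrite big_ord0.
  by rewrite (integral_cst _ measurableT) mul1e expr0; exact: probability_setT.
have mp n : measurable_fun [set: n.-tuple RT]
    (fun g : n.-tuple RT => (\prod_(i < n) h (tnth g i))%:E).
  by apply/measurable_EFinP; apply: measurable_prod => i _;
    exact: measurable_tnth_comp.
have p0 n (g : n.-tuple RT) : 0 <= \prod_(i < n) h (tnth g i).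
  by apply: prodr_ge0.
rewrite std_gaussian_tonelli//; last by move=> g; rewrite lee_fin.
transitivity (\int[normal_prob (0 : R) 1]_x ((c ^+ k)%:E * (h x)%:E))%E.
  apply: eq_integral => x _.
  under eq_integral => g _.
    rewrite big_ord_recl tnth0.
    under eq_bigr do rewrite tnthS.
    rewrite EFinM; over.
  rewrite ge0_integralZl; [by rewrite IH muleC|exact: measurableT|exact: mp| |].
    by move=> g _; rewrite lee_fin.
  by rewrite lee_fin.
rewrite ge0_integralZl//; last 3 first.
- by apply/measurable_EFinP.
- by move=> x _; rewrite lee_fin.
- rewrite lee_fin exprn_ge0// -lee_fin -hc.
  by apply: integral_ge0 => x _; rewrite lee_fin.
by rewrite hc -EFinM exprSr.
Qed.

Lemma std_gaussian_mgf k (l : R) :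
  (\int[std_gaussian R k]_g (expR (l * \sum_(i < k) tnth g i))%:E =
   (expR (k%:R * (l ^+ 2 / 2)))%:E)%E.
Proof.
rewrite expRM_natl -(@ge0_integral_std_gaussian_prod k (fun x => expR (l * x)));
  last 3 first.
- by apply: measurableT_comp => //; exact: mulrl_measurable.
- by move=> x; rewrite expR_ge0.
- exact: normal_mgf.
by apply: eq_integral => g _; rewrite mulr_sumr expR_sum.
Qed.

(** Flipping the sign of one coordinate preserves the Gaussian measure; this is
    the reason why moments with an odd exponent vanish. *)
Definition flip_coord k (i : 'I_k) (g : k.-tuple RT) : k.-tuple RT :=
  [tuple (if j == i then - tnth g j else tnth g j) | j < k].

Lemma measurable_flip_coord k (i : 'I_k) :
  measurable_fun [set: k.-tuple RT] (flip_coord i).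
Proof.
apply/measurable_fun_tnthP => j.
rewrite (_ : _ \o _ = fun g : k.-tuple RT =>
    if j == i then - tnth g j else tnth g j); last first.
  by apply/funext => g /=; rewrite tnth_mktuple.
case: (j == i); last exact: measurable_tnth.
exact: (@measurable_tnth_comp k -%R j (@oppr_measurable R setT)).
Qed.

Lemma ge0_integral_flip_coord k (i : 'I_k) (f : k.-tuple RT -> \bar R) :
  measurable_fun [set: k.-tuple RT] f -> (forall g, 0 <= f g)%E ->
  (\int[std_gaussian R k]_g f (flip_coord i g) = \int[std_gaussian R k]_g f g)%E.
Proof.
elim: k i f => [[]//|k IH] i f mf f0.
have mfc (x : R) : measurable_fun [set: k.-tuple RT]
    (fun g : k.-tuple RT => f [tuple of x :: g]).
  exact: (measurableT_comp mf (@measurable_cons1 k x)).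
rewrite (std_gaussian_tonelli mf f0).
rewrite (std_gaussian_tonelli (f := fun g => f (flip_coord i g))); last 2 first.
- exact: (measurableT_comp mf (measurable_flip_coord i)).
- by move=> g; exact: f0.
case: (unliftP ord0 i) => [j ->|->].
  apply: eq_integral => x _; rewrite -[RHS](IH j)//.
  apply: eq_integral => g _; congr f; apply: eq_from_tnth => l.
  rewrite tnth_mktuple; case: (unliftP ord0 l) => [m ->|->].
    by rewrite !tnthS tnth_mktuple (inj_eq lift_inj).
  by rewrite !tnth0.
rewrite -[RHS]ge0_integral_normal_opp; last 2 first.
- apply: (@measurable_fun_fubini_tonelli_F _ _ _ _ _ (std_gaussian R k)
    (fun p : RT * k.-tuple RT => f [tuple of p.1 :: p.2])); last first.
    by move=> p; exact: f0.
  exact: (measurableT_comp mf (@measurable_cons_pair R k)).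
- by move=> x; apply: integral_ge0.
apply: eq_integral => x _; apply: eq_integral => g _; congr f.
apply: eq_from_tnth => l; rewrite tnth_mktuple.
by case: (unliftP ord0 l) => [m ->|->]; rewrite ?tnthS ?tnth0.
Qed.

(** From |x|^a / a! <= e^|x| <= e^x + e^(-x); the constant q! serves all
    exponents a <= q at once, and the right side is even in x. *)
Lemma normX_le_expR (x : R) (a q : nat) : (a <= q)%N ->
  `|x| ^+ a <= q`!%:R * (expR x + expR (- x)).
Proof.
move=> aq.
have h : expR `|x| <= expR x + expR (- x).
  by case: (ger0P x) => _; rewrite ?lerDl ?lerDr expR_ge0.
have qa : (a`!%:R : R) <= q`!%:R by rewrite ler_nat leq_fact.
apply: (@le_trans _ _ (a`!%:R * expR `|x|)); last first.
  by apply: ler_pM => //; rewrite expR_ge0.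
case: a {aq qa} => [|a].
  by rewrite expr0 fact0 mul1r -[leLHS]expR0 ler_expR.
have := expR_ge1Dxn a (normr_ge0 x).
rewrite -ler_pdivrMl ?ltr0n ?fact_gt0//.
by apply: le_trans; rewrite mulrC lerDr.
Qed.

Local Notation mono w g := (\prod_(j <- w) tnth g j).

Lemma prod_count_mem k (w : seq 'I_k) (y : 'I_k -> R) :
  \prod_(j <- w) y j = \prod_(i < k) y i ^+ count_mem i w.
Proof.
elim: w => [|j w IH]; first by rewrite big_nil big1.
rewrite big_cons IH /= (bigD1 j)//= [RHS](bigD1 j)//= eqxx exprS mulrA.
by congr (_ * _); apply: eq_bigr => i /negPf ij; rewrite eq_sym ij.
Qed.

Lemma prod_flip_sign k (w : seq 'I_k) (i : 'I_k) (y z : 'I_k -> R) :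
  odd (count_mem i w) -> z i = - y i -> (forall j, j != i -> z j = y j) ->
  \prod_(j <- w) z j = - \prod_(j <- w) y j.
Proof.
move=> oi zi zj; rewrite [LHS]prod_count_mem [in RHS]prod_count_mem.
rewrite (bigD1 i)//= [in RHS](bigD1 i)//=.
rewrite zi exprNn -signr_odd oi expr1 mulN1r mulNr; congr (- (_ * _)).
by apply: eq_bigr => j /zj ->.
Qed.

(** An integrable majorant of all monomials with q factors that, being a product
    of even functions of the coordinates, is invariant under [flip_coord]. *)
Definition exp_majorant k (q : nat) (g : k.-tuple RT) : R :=
  \prod_(i < k) (q`!%:R * (expR (tnth g i) + expR (- tnth g i))).

Lemma exp_majorant_ge0 k q (g : k.-tuple RT) : 0 <= exp_majorant q g.
Proof. by apply: prodr_ge0 => i _; rewrite mulr_ge0// addr_ge0// expR_ge0. Qed.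

Lemma normr_mono_le k (w : seq 'I_k) (g : k.-tuple RT) :
  `|mono w g| <= exp_majorant (size w) g.
Proof.
rewrite prod_count_mem normr_prod; apply: ler_prod => i _.
by rewrite normr_ge0 normrX normX_le_expR// count_size.
Qed.

Lemma measurable_exp_majorant k q :
  measurable_fun [set: k.-tuple RT] (@exp_majorant k q).
Proof.
apply: measurable_prod => i _.
apply: (@measurable_tnth_comp k (fun x => q`!%:R * (expR x + expR (- x)))).
apply: measurable_funM => //; apply: measurable_funD => //.
by apply: measurableT_comp => //; exact: oppr_measurable.
Qed.

Lemma measurable_mono k (w : seq 'I_k) :
  measurable_fun [set: k.-tuple RT] (fun g : k.-tuple RT => mono w g).
Proof.
by apply: measurable_prod => i _; exact: measurable_tnth.
Qed.

Lemma integrable_exp_majorant k q :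
  (std_gaussian R k).-integrable setT (EFin \o @exp_majorant k q).
Proof.
apply/integrableP; split.
  by apply/measurable_EFinP; exact: measurable_exp_majorant.
under eq_integral => g _ do
  rewrite /= ger0_norm ?exp_majorant_ge0//.
rewrite (@ge0_integral_std_gaussian_prod k
  (fun x => q`!%:R * (expR x + expR (- x))) (q`!%:R * (expR (1 / 2) *+ 2)));
  last 3 first.
- apply: measurable_funM => //; apply: measurable_funD => //.
  by apply: measurableT_comp => //; exact: oppr_measurable.
- by move=> x; rewrite mulr_ge0// addr_ge0// expR_ge0.
- under eq_integral do rewrite EFinM.
  have mN : measurable_fun [set: R] (fun x : R => expR (- x)).
    by apply: measurableT_comp => //; exact: oppr_measurable.
  rewrite ge0_integralZl//; last first.
    by apply/measurable_EFinP; apply: measurable_funD.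
  under eq_integral do rewrite EFinD.
  rewrite ge0_integralD//; [|exact/measurable_EFinP..].
  have m (c : R) : `|c| = 1 -> (\int[normal_prob (0 : R) 1]_x
      (expR (c * x))%:E = (expR (1 / 2))%:E)%E.
    by move=> c1; rewrite normal_mgf -real_normK ?num_real// c1 expr1n.
  have m1 := m 1 (normr1 _); have mN1 := m (-1) (normrN1 _).
  under eq_integral do rewrite -[X in expR X]mul1r.
  rewrite m1; under eq_integral do rewrite -mulN1r.
  by rewrite mN1 -EFinD -EFinM mulr2n.
by rewrite ltry.
Qed.

Lemma integrable_mono k (w : seq 'I_k) :
  (std_gaussian R k).-integrable setT
    (fun g : k.-tuple RT => (mono w g)%:E).
Proof.
apply: (le_integrable _ _ _ (@integrable_exp_majorant k (size w))) => //.
  by apply/measurable_EFinP; exact: measurable_mono.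
move=> g _ /=; rewrite lee_fin [leRHS]ger0_norm ?exp_majorant_ge0//.
exact: normr_mono_le.
Qed.

(** Flipping coordinate i changes the sign of the monomial W and fixes the
    majorant D, so D + W >= 0 and D - W have the same integral. Adding D makes
    the integrand nonnegative, as invariance is only available there. *)
Lemma integral_mono_odd k (w : seq 'I_k) (i : 'I_k) : odd (count_mem i w) ->
  (\int[std_gaussian R k]_g (mono w g)%:E = 0)%E.
Proof.
move=> oi.
pose D := @exp_majorant k (size w).
have Df g : D (flip_coord i g) = D g.
  apply: eq_bigr => j _; rewrite tnth_mktuple; case: ifP => // _.
  by rewrite opprK addrC.
have Wf g : mono w (flip_coord i g) = - mono w g.
  apply: (@prod_flip_sign _ _ i) => // [|j /negPf ji].
    by rewrite tnth_mktuple eqxx.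
  by rewrite tnth_mktuple ji.
have iW := integrable_mono w.
have iD : (std_gaussian R k).-integrable setT
  (fun g : k.-tuple RT => (D g)%:E) := @integrable_exp_majorant k (size w).
have mDW : measurable_fun [set: k.-tuple RT]
    (fun g : k.-tuple RT => (D g + mono w g)%:E).
  apply/measurable_EFinP; apply: measurable_funD; first exact: measurable_exp_majorant.
  exact: measurable_mono.
have := ge0_integral_flip_coord i mDW.
have DW0 (g : k.-tuple RT) : (0 <= (D g + mono w g)%:E)%E.
  rewrite lee_fin -lerBlDr sub0r (le_trans _ (normr_mono_le w g))//.
  by rewrite -normrN ler_norm.
move=> /(_ DW0).
under eq_integral do rewrite Df Wf EFinD EFinN.
under [in X in _ = X -> _]eq_integral do rewrite EFinD.
rewrite integralB// integralD//.
have fD := integrable_fin_num measurableT iD.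
have fW := integrable_fin_num measurableT iW.
rewrite -(fineK fD) -(fineK fW) -EFinB -EFinD => -[] h.
by congr EFin; lra.
Qed.

(** Either some exponent is odd and the moment vanishes, or the monomial is a
    product of squares. *)
Lemma integral_mono_ge0 k (w : seq 'I_k) :
  (0 <= \int[std_gaussian R k]_g (mono w g)%:E)%E.
Proof.
have [/forallP ev|] := boolP [forall i, ~~ odd (count_mem i w)].
  apply: integral_ge0 => g _; rewrite lee_fin prod_count_mem prodr_ge0// => i _.
  exact: exprn_even_ge0.
rewrite negb_forall => /existsP[i]; rewrite negbK => oi.
by rewrite (integral_mono_odd oi).
Qed.

(** Recursion on the length, instead of a sum over tuples, makes expansion of
    powers and exchange with the integral plain inductions. *)
Fixpoint sum_words k (q : nat) (F : seq 'I_k -> R) : R :=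
  if q is q'.+1 then \sum_(i < k) sum_words q' (fun w => F (i :: w)) else F [::].

Lemma sum_words_exp k q (y : 'I_k -> R) :
  sum_words q (fun w => \prod_(j <- w) y j) = (\sum_(i < k) y i) ^+ q.
Proof.
have H c : sum_words q (fun w => c * \prod_(j <- w) y j) =
    c * (\sum_(i < k) y i) ^+ q.
  elim: q c => [|q IH] c /=; first by rewrite big_nil expr0.
  rewrite exprS mulrA mulr_sumr mulr_suml; apply: eq_bigr => i _.
  rewrite -IH; congr sum_words; apply/funext => w.
  by rewrite big_cons mulrA.
by have := H 1; rewrite mul1r => <-; congr sum_words; apply/funext => w; rewrite mul1r.
Qed.

Lemma ler_sum_words k q (F G : seq 'I_k -> R) :
  (forall w, size w = q -> F w <= G w) -> sum_words q F <= sum_words q G.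
Proof.
elim: q F G => [|q IH] F G h /=; first exact: h.
by apply: ler_sum => i _; apply: IH => w sw; apply: h; rewrite /= sw.
Qed.

Lemma sum_words_mull k q (c : R) (F : seq 'I_k -> R) :
  sum_words q (fun w => c * F w) = c * sum_words q F.
Proof.
by elim: q F => [//|q IH] F /=; rewrite mulr_sumr; apply: eq_bigr => i _.
Qed.

Lemma integral_sum_words k q (f : seq 'I_k -> k.-tuple RT -> R) :
  (forall w, (std_gaussian R k).-integrable setT (EFin \o f w)) ->
  (std_gaussian R k).-integrable setT
    (fun g => (sum_words q (fun w => f w g))%:E) /\
  (\int[std_gaussian R k]_g (sum_words q (fun w => f w g))%:E =
   (sum_words q (fun w => fine (\int[std_gaussian R k]_g (f w g)%:E)))%:E)%E.
Proof.
elim: q f => [|q IH] f fi /=.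
  split; first exact: fi.
  by rewrite fineK//; exact: (integrable_fin_num measurableT (fi [::])).
have fi1 i := IH (fun w => f (i :: w)) (fun w => fi (i :: w)).
split.
  rewrite (_ : (fun _ => _) = (fun g => \sum_(i < k)
      (sum_words q (fun w => f (i :: w) g))%:E)%E).
    by apply: integrable_sum => // i _; exact: (fi1 i).1.
  by apply/funext => g; rewrite sumEFin.
under eq_integral do rewrite -sumEFin.
rewrite integral_sum//; last by move=> i; exact: (fi1 i).1.
by rewrite -sumEFin; apply: eq_bigr => i _; exact: (fi1 i).2.
Qed.

Lemma exprn_le_expR_sum (x l : R) q : 0 < l -> ~~ odd q ->
  x ^+ q <= q`!%:R / l ^+ q * (expR (l * x) + expR (- l * x)).
Proof.
move=> l0 evq; have lq : 0 < l ^+ q by rewrite exprn_gt0.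
rewrite mulrAC ler_pdivlMr// mulrC -exprMn.
have -> : (l * x) ^+ q = `|l * x| ^+ q.
  by rewrite -normrX ger0_norm// exprn_even_ge0.
by rewrite mulNr; exact: normX_le_expR.
Qed.

(** The q-th moment of sum_i g_i from its moment generating function, which
    factors over the coordinates; l is left free, to be optimised later. *)
Lemma integral_sum_exp_le k q (l : R) : 0 < l -> ~~ odd q ->
  (\int[std_gaussian R k]_g ((\sum_(i < k) tnth g i) ^+ q)%:E <=
   (q`!%:R / l ^+ q * (expR (k%:R * (l ^+ 2 / 2)) *+ 2))%:E)%E.
Proof.
move=> l0 evq.
have mS : measurable_fun [set: k.-tuple RT]
    (fun g : k.-tuple RT => \sum_(i < k) tnth g i).
  by apply: measurable_sum => i; exact: measurable_tnth.
have me (c : R) : measurable_fun [set: k.-tuple RT]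
    (fun g : k.-tuple RT => (expR (c * \sum_(i < k) tnth g i))%:E).
  apply/measurable_EFinP; apply: measurableT_comp => //.
  exact: measurable_funM.
have c0 : 0 <= q`!%:R / l ^+ q by rewrite divr_ge0// exprn_ge0// ltW.
apply: (@le_trans _ _ (\int[std_gaussian R k]_g ((q`!%:R / l ^+ q)%:E *
   ((expR (l * \sum_(i < k) tnth g i))%:E +
    (expR (- l * \sum_(i < k) tnth g i))%:E)))%E).
  apply: ge0_le_integral => //.
  - by move=> g _; rewrite lee_fin exprn_even_ge0.
  - by apply/measurable_EFinP; exact: measurable_funX.
  - by apply: emeasurable_funM => //; exact: emeasurable_funD.
  - by move=> g _; rewrite -EFinD -EFinM lee_fin; exact: exprn_le_expR_sum.
rewrite ge0_integralZl//; last 2 first.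
- exact: emeasurable_funD.
- by move=> g _; rewrite adde_ge0// lee_fin expR_ge0.
rewrite ge0_integralD//.
by rewrite !std_gaussian_mgf sqrrN -EFinD -EFinM mulr2n.
Qed.

(** As Gaussian moments are nonnegative, coefficients between 0 and B may all be
    replaced by B, and the sum of all moments of length q is the q-th moment of
    sum_i g_i. *)
Lemma integral_sum_words_le k q (B l : R) (Phi : seq 'I_k -> R) :
  0 < l -> ~~ odd q -> 0 <= B ->
  (forall w, size w = q -> 0 <= Phi w <= B) ->
  (std_gaussian R k).-integrable setT
    (fun g => (sum_words q (fun w => Phi w * mono w g))%:E) /\
  (\int[std_gaussian R k]_g (sum_words q (fun w => Phi w * mono w g))%:E <=
   (B * (q`!%:R / l ^+ q * (expR (k%:R * (l ^+ 2 / 2)) *+ 2)))%:E)%E.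
Proof.
move=> l0 evq B0 PhiB.
have iP (w : seq 'I_k) : (std_gaussian R k).-integrable setT
    (EFin \o (fun g => Phi w * mono w g)).
  exact: (integrableZl measurableT (Phi w) (integrable_mono w)).
have [h1 h2] := integral_sum_words q iP; split => //; rewrite h2.
have [_ h3] := integral_sum_words q (@integrable_mono k).
have := integral_sum_exp_le k l0 evq.
under eq_integral do rewrite -sum_words_exp.
rewrite h3 !lee_fin => h4; apply: le_trans (ler_wpM2l B0 h4).
rewrite -sum_words_mull; apply: ler_sum_words => w /PhiB/andP[P0 PB].
under eq_integral do rewrite EFinM.
rewrite integralZl//; last exact: integrable_mono.
rewrite fineM//; last exact: integrable_fin_num (integrable_mono w).
by rewrite ler_wpM2r// fine_ge0// integral_mono_ge0.
Qed.

End gaussian_moments.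

(** * Gaussian width from a polynomial moment *)

Section gaussian_width_moment.
Variable R : realType.
Local Notation RT := (measurableTypeR R).

Lemma measurable_bigmaxr d (T : measurableType d) (I : Type) (s : seq I)
    (f0 : T -> R) (f : I -> T -> R) :
  measurable_fun [set: T] f0 -> (forall i, measurable_fun [set: T] (f i)) ->
  measurable_fun [set: T] (fun x => \big[Num.max/f0 x]_(i <- s) f i x).
Proof.
move=> m0 mf; elim: s => [|i s IH].
  by rewrite (_ : (fun _ => _) = f0)//; apply/funext => x; rewrite big_nil.
rewrite (_ : (fun _ => _) =
    f i \max (fun x => \big[Num.max/f0 x]_(j <- s) f j x)); last first.
  by apply/funext => x; rewrite big_cons.
exact: measurable_maxr.
Qed.

Lemma ereal_sup_range_bigmax (I : finType) (i0 : I) (y : I -> R) :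
  ereal_sup (range (fun i => (y i)%:E)) = (\big[Num.max/y i0]_i y i)%:E.
Proof.
apply/eqP; rewrite eq_le; apply/andP; split.
  apply: ge_ereal_sup => _ [i _ <-]; rewrite lee_fin.
  exact: le_bigmax.
have le_sup i : ((y i)%:E <= ereal_sup (range (fun i => (y i)%:E)))%E.
  by apply: ereal_sup_ubound; exists i.
apply: (big_ind (fun r => (r%:E <= ereal_sup (range (fun i => (y i)%:E)))%E)).
- exact: le_sup.
- by move=> u v hu hv; case: (leP u v).
- by move=> i _; exact: le_sup.
Qed.

(** Young's inequality in the form that bounds y by a polynomial of y, so that
    only the integral of a polynomial is needed. *)
Lemma le_young_even (a y : R) q : 0 < a -> ~~ odd q -> (0 < q)%N ->
  y <= a + y ^+ q / a ^+ q.-1.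
Proof.
move=> a0 evq q0; have aq : 0 < a ^+ q.-1 by rewrite exprn_gt0.
have yq : 0 <= y ^+ q by rewrite exprn_even_ge0.
have [ya|ay] := leP y a.
  by rewrite (le_trans ya)// lerDl divr_ge0// ltW.
apply: ler_wpDl; first exact: ltW.
rewrite ler_pdivlMr// -[in leRHS](prednK q0) exprS.
rewrite ler_wpM2l//; first by rewrite ltW// (lt_trans a0).
by rewrite lerXn2r ?nnegrE// ltW// (lt_trans a0).
Qed.

Lemma normr_le_bounds (x y z : R) : x <= y -> y <= z -> `|y| <= `|z| + `|x|.
Proof.
move=> xy yz; rewrite ler_norml; apply/andP; split.
  rewrite (le_trans _ xy)// lerNl (le_trans (ler_norm _))// normrN.
  by rewrite lerDr.
by rewrite (le_trans yz)// (le_trans (ler_norm z))// lerDl.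
Qed.

(** Subtracting the linear function attached to one point X i0 of the set leaves
    the width unchanged, as its mean is 0; [le_young_even] then bounds the
    supremum of the remaining functions by a + K T / a^(q-1), where T is the
    polynomial of [integral_sum_words_le], and the last hypothesis makes the
    mean of the second term at most a. *)
Lemma gaussian_width_le_moment k (I : finType) (X : I -> 'rV[R]_k) (i0 : I)
    (q : nat) (a l K B : R) (Phi : seq 'I_k -> R) :
  0 < a -> 0 < l -> 0 <= K -> 0 <= B -> ~~ odd q -> (0 < q)%N ->
  (forall w, size w = q -> 0 <= Phi w <= B) ->
  (forall i (y : 'I_k -> R), (\sum_(j < k) (X i 0 j - X i0 0 j) * y j) ^+ q <=
     K * sum_words q (fun w => Phi w * \prod_(j <- w) y j)) ->
  K * (B * (q`!%:R / l ^+ q * (expR (k%:R * (l ^+ 2 / 2)) *+ 2))) <= a ^+ q ->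
  (gaussian_width [set X i | i in [set: I]] <= (a *+ 2)%:E)%E.
Proof.
move=> a0 l0 K0 B0 evq q0 PhiB XK Ka.
have aq : 0 < a ^+ q.-1 by rewrite exprn_gt0.
pose f i (g : k.-tuple RT) := \sum_(j < k) X i 0 j * tnth g j.
pose T (g : k.-tuple RT) :=
  sum_words q (fun w => Phi w * \prod_(j <- w) tnth g j).
have [iT leT] := integral_sum_words_le l0 evq B0 PhiB.
have mf i : measurable_fun [set: k.-tuple RT] (f i).
  apply: measurable_sum => j; apply: measurable_funM => //.
  exact: measurable_tnth.
have linE (c : R) j : (fun g : k.-tuple RT => (c * tnth g j)%:E) =
    (fun g => c%:E * (\prod_(l <- [:: j]) tnth g l)%:E)%E.
  by apply/funext => g; rewrite big_seq1 EFinM.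
have ilin (c : R) j : (std_gaussian R k).-integrable setT
    (fun g : k.-tuple RT => (c * tnth g j)%:E).
  by rewrite linE; apply: integrableZl => //; exact: integrable_mono.
have if_ i : (std_gaussian R k).-integrable setT (EFin \o f i).
  rewrite (_ : _ \o _ = fun g => (\sum_(j < k)
      (X i 0 j * tnth g j)%:E)%E); first exact: integrable_sum.
  by apply/funext => g /=; rewrite -sumEFin.
have intf : (\int[std_gaussian R k]_g (f i0 g)%:E = 0)%E.
  under eq_integral do rewrite -sumEFin.
  rewrite integral_sum//; apply: big1 => j _; rewrite linE.
  rewrite integralZl//; last exact: integrable_mono.
  by rewrite (@integral_mono_odd _ _ _ j) ?mule0//= eqxx.
pose U g := ((f i0 g)%:E + (a%:E + (K / a ^+ q.-1)%:E * (T g)%:E))%E.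
have iKT : (std_gaussian R k).-integrable setT
    (fun g => (K / a ^+ q.-1)%:E * (T g)%:E)%E by exact: integrableZl.
have ia : (std_gaussian R k).-integrable setT (cst a%:E).
  by apply: finite_measure_integrable_cst.
have iaKT : (std_gaussian R k).-integrable setT
    (fun g => a%:E + (K / a ^+ q.-1)%:E * (T g)%:E)%E by exact: integrableD.
have iU : (std_gaussian R k).-integrable setT U.
  by apply: integrableD => //; exact: if_.
(* U is a polynomial majorant of all the linear functions f i. *)
have fU i g : ((f i g)%:E <= U g)%E.
  rewrite /U -EFinM -!EFinD lee_fin.
  pose y := \sum_(j < k) (X i 0 j - X i0 0 j) * tnth g j.
  have -> : f i g = f i0 g + y.
    rewrite /f /y -big_split; apply: eq_bigr => j _ /=; by ring.
  rewrite lerD2l (le_trans (le_young_even y a0 evq q0))// lerD2l mulrAC.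
  by rewrite ler_pM2r ?invr_gt0//; exact: XK.
pose h (g : k.-tuple RT) := \big[Num.max/f i0 g]_i f i g.
have hE (g : k.-tuple RT) : ereal_sup [set (\sum_(i < k) x 0 i * tnth g i)%:E
    | x in [set X i | i in [set: I]]] = (h g)%:E.
  rewrite -ereal_sup_range_bigmax; congr ereal_sup.
  apply/seteqP; split => [_ [_ [i _ <-] <-]|_ [i _ <-]]; first by exists i.
  by exists (X i) => //; exists i.
have hU g : ((h g)%:E <= U g)%E.
  by rewrite -ereal_sup_range_bigmax; apply: ge_ereal_sup => _ [i _ <-].
have fh g : f i0 g <= h g by exact: le_bigmax.
have mh : measurable_fun [set: k.-tuple RT] h by exact: measurable_bigmaxr.
have ih : (std_gaussian R k).-integrable setT (EFin \o h).
  pose u g := f i0 g + (a + K / a ^+ q.-1 * T g).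
  have iu : (std_gaussian R k).-integrable setT
      (fun g => (`|u g| + `|f i0 g|)%:E).
    exact: (integrableD measurableT (integrable_abse iU)
      (integrable_abse (if_ i0))).
  apply: (le_integrable _ _ _ iu) => //; first exact/measurable_EFinP.
  move=> g _ /=; rewrite lee_fin [leRHS]ger0_norm ?addr_ge0//.
  have hu : h g <= u g by have := hU g; rewrite lee_fin.
  exact: normr_le_bounds.
rewrite /gaussian_width; under eq_integral do rewrite hE.
apply: (le_trans (le_integral measurableT ih iU (fun g _ => hU g))).
rewrite integralD//; last exact: if_.
rewrite intf add0e integralD// integralZl//.
rewrite integral_cst//= probability_setT mule1 mulr2n EFinD leeD2l//.
apply: (@le_trans _ _ ((K / a ^+ q.-1)%:E *
  (B * (q`!%:R / l ^+ q * (expR (k%:R * (l ^+ 2 / 2)) *+ 2)))%:E)%E).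
  by rewrite lee_wpmul2l// lee_fin divr_ge0// ltW.
rewrite -EFinM lee_fin mulrAC ler_pdivrMr//.
by rewrite -exprS prednK.
Qed.

End gaussian_width_moment.

(** * Quadratic forms and trace moments *)

Section trace_moments.
Variable R : realType.

(** Lagrange's identity: the difference of the two sides is half the sum of the
    squares (a_i b_j - a_j b_i)^2. *)
Lemma sum_cauchy_schwarz (I : finType) (a b : I -> R) :
  (\sum_i a i * b i) ^+ 2 <= (\sum_i a i ^+ 2) * (\sum_i b i ^+ 2).
Proof.
have E (u v : I -> R) :
    (\sum_i u i) * (\sum_j v j) = \sum_i \sum_j u i * v j.
  by rewrite mulr_suml; apply: eq_bigr => i _; rewrite mulr_sumr.
have h : 0 <= \sum_i \sum_j (a i * b j - a j * b i) ^+ 2.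
  by apply: sumr_ge0 => i _; apply: sumr_ge0 => j _; exact: sqr_ge0.
suff : \sum_i \sum_j (a i * b j - a j * b i) ^+ 2 =
    ((\sum_i a i ^+ 2) * (\sum_i b i ^+ 2) - (\sum_i a i * b i) ^+ 2) *+ 2.
  by move=> e; move: h; rewrite e pmulrn_lge0// subr_ge0.
have -> : (\sum_i a i * b i) ^+ 2 = \sum_i \sum_j a i * b i * (a j * b j).
  by rewrite expr2 E.
rewrite mulr2n {2}mulrC !E addrACA -opprD.
rewrite -!big_split -sumrN -big_split; apply: eq_bigr => i _ /=.
rewrite -!big_split -sumrN -big_split; apply: eq_bigr => j _ /=.
by ring.
Qed.

Definition qform n (A : 'M[R]_n) (v : 'I_n -> R) : R :=
  \sum_i \sum_j v i * A i j * v j.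

(** Cauchy-Schwarz for v and A v, since v^T A^2 v = |A v|^2 for symmetric A. *)
Lemma qform_sqr_le n (A : 'M[R]_n) v : A^T = A ->
  qform A v ^+ 2 <= (\sum_i v i ^+ 2) * qform (A ^+ 2) v.
Proof.
move=> sA; have -> : qform A v = \sum_i v i * \sum_j A i j * v j.
  by apply: eq_bigr => i _; rewrite mulr_sumr; apply: eq_bigr => j _; rewrite mulrA.
have -> : qform (A ^+ 2) v = \sum_i (\sum_j A i j * v j) ^+ 2.
  transitivity (\sum_x \sum_y \sum_i (v x * A i x) * (A i y * v y)).
    apply: eq_bigr => x _; apply: eq_bigr => y _.
    rewrite expr2 mxE mulr_sumr mulr_suml; apply: eq_bigr => i _.
    by rewrite -{1}sA mxE !mulrA.
  rewrite exchange_big; under [RHS]eq_bigr do rewrite expr2.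
  under eq_bigr => x _ do rewrite exchange_big.
  rewrite exchange_big/=; apply: eq_bigr => i _.
  rewrite exchange_big mulr_suml; apply: eq_bigr => x _ /=.
  by rewrite mulr_sumr; apply: eq_bigr => y _; rewrite [v x * _]mulrC.
exact: sum_cauchy_schwarz.
Qed.

(** Doubling of the exponent by [qform_sqr_le], applied to A^2, until the last
    step, where Cauchy-Schwarz over all pairs of indices produces
    tr(A^2) = |A|^2. This replaces the bound of the spectral norm by a trace,
    without diagonalisation. *)
Lemma qform_exp_le_trace n (A : 'M[R]_n) v h : A^T = A ->
  qform A v ^+ (2 ^ h.+1) <=
  (\sum_i v i ^+ 2) ^+ (2 ^ h.+1) * \tr (A ^+ (2 ^ h.+1)).
Proof.
have s0 : 0 <= \sum_i v i ^+ 2 by apply: sumr_ge0 => i _; exact: sqr_ge0.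
elim: h A => [|h IH] A sA.
  rewrite expn1; have -> : qform A v = \sum_(p : 'I_n * 'I_n)
      (v p.1 * v p.2) * A p.1 p.2.
    rewrite /qform pair_big; apply: eq_bigr => -[i j] _ /=; ring.
  apply: le_trans (sum_cauchy_schwarz _ _) _.
  rewrite le_eqVlt; apply/orP; left; apply/eqP; congr (_ * _).
    rewrite expr2 mulr_suml.
    under [RHS]eq_bigr do rewrite mulr_sumr.
    by rewrite pair_big; apply: eq_bigr => -[i j] _ /=; rewrite exprMn.
  rewrite /mxtrace -(pair_big xpredT xpredT (fun i j => A i j ^+ 2))/=.
  apply: eq_bigr => i _; rewrite expr2 mxE; apply: eq_bigr => j _.
  by rewrite expr2 -{4}sA mxE.
rewrite (expnS 2 h.+1) !(exprM _ 2).
have sA2 : (A ^+ 2)^T = A ^+ 2 by rewrite expr2 -mulmxE trmx_mul sA.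
have q0 : 0 <= qform A v ^+ 2 by exact: sqr_ge0.
apply: (@le_trans _ _
  (((\sum_i v i ^+ 2) * qform (A ^+ 2) v) ^+ (2 ^ h.+1))).
  rewrite lerXn2r ?nnegrE//; last exact: qform_sqr_le.
  exact: le_trans (qform_sqr_le v sA).
rewrite exprMn [X in _ <= X * _](_ : _ =
  (\sum_i v i ^+ 2) ^+ (2 ^ h.+1) * (\sum_i v i ^+ 2) ^+ (2 ^ h.+1)); last first.
  by rewrite -exprM -exprD mul2n addnn.
by rewrite -mulrA ler_wpM2l ?exprn_ge0// IH.
Qed.

(** The matrices A i need not commute, hence a sum over words. *)
Lemma trace_exp_sum_words n k (A : 'I_k -> 'M[R]_n) (y : 'I_k -> R) q :
  \tr ((\sum_i y i *: A i) ^+ q) =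
  sum_words q (fun w => \tr (\prod_(j <- w) A j) * \prod_(j <- w) y j).
Proof.
(* The induction needs an arbitrary matrix M in front of the power. *)
suff H M : \tr (M * (\sum_i y i *: A i) ^+ q) =
    sum_words q (fun w => \tr (M * \prod_(j <- w) A j) * \prod_(j <- w) y j).
  have := H 1; rewrite mul1r => ->; congr sum_words.
  by apply/funext => w; rewrite mul1r.
elim: q M => [|q IH] M /=; first by rewrite !big_nil mulr1.
rewrite exprS mulrA mulr_sumr mulr_suml raddf_sum; apply: eq_bigr => i _ /=.
rewrite -!mulmxE -scalemxAr -scalemxAl linearZ/= mulmxE IH -sum_words_mull.
by congr sum_words; apply/funext => w; rewrite !big_cons (mulrA M) mulrCA.
Qed.

(** Row sums of nonnegative matrices are submultiplicative, and each diagonal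
    entry is at most its row sum. *)
Lemma trace_prod_bounds n k (A : 'I_k -> 'M[R]_n) (tau : R) (w : seq 'I_k) :
  (forall i x y, 0 <= A i x y) -> (forall i x, \sum_y A i x y <= tau) ->
  0 <= tau ->
  0 <= \tr (\prod_(j <- w) A j) <= n%:R * tau ^+ size w.
Proof.
move=> A0 At t0.
have H : (forall x y, 0 <= (\prod_(j <- w) A j) x y) /\
    (forall x, \sum_y (\prod_(j <- w) A j) x y <= tau ^+ size w).
  elim: w => [|i w [IH0 IHt]].
    rewrite big_nil expr0; split=> [x y|x]; first by rewrite mxE ler0n.
    rewrite (bigD1 x)//= mxE eqxx big1 ?addr0// => y yx.
    by rewrite mxE eq_sym (negPf yx).
  rewrite big_cons; split=> [x y|x].
    by rewrite mxE sumr_ge0// => z _; rewrite mulr_ge0.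
  have -> : \sum_y (A i * \prod_(j <- w) A j) x y =
      \sum_y \sum_z A i x z * (\prod_(j <- w) A j) z y.
    by apply: eq_bigr => y _; rewrite mxE.
  rewrite exchange_big/= exprS.
  apply: (@le_trans _ _ (\sum_z A i x z * tau ^+ size w)).
    by apply: ler_sum => z _; rewrite -mulr_sumr ler_wpM2l.
  by rewrite -mulr_suml ler_wpM2r// exprn_ge0.
case: H => H0 Ht; apply/andP; split; first by apply: sumr_ge0 => x _.
apply: (@le_trans _ _ (\sum_(x < n) tau ^+ size w)).
  apply: ler_sum => x _; apply: le_trans (Ht x).
  by rewrite (bigD1 x)//= lerDl sumr_ge0.
by rewrite sumr_const card_ord mulr_natl.
Qed.

End trace_moments.

(** * Kikuchi matrices *)

Section kikuchi.
Variables (R : realType) (V E : finType) (r m t : nat).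
Variables (u v : E -> 'I_r -> V).
Local Notation nu := #|V|.
Local Notation pos := ('I_r * 'I_m)%type.
Local Notation word := {ffun pos -> V}.
Local Notation slots := {ffun 'I_r -> 'I_m}.
Implicit Types (a c : 'I_r -> V) (b : slots) (F : word).

(** A choice b of one position in each of the r rows of a word; arranging words
    in rows keeps the chosen positions distinct, and makes all the counts
    factor over the rows. *)
Definition occurs_at a b F := [forall l, F (l, b l) == a l].

Definition overwrite a b F : word :=
  [ffun p => if p.2 == b p.1 then a p.1 else F p].

(** Overwriting a by c is undone by overwriting c by a: links can be read in
    both directions. *)
Lemma occurs_overwrite a c b F F' :
  occurs_at a b F && (F' == overwrite c b F) =
  occurs_at c b F' && (F == overwrite a b F').
Proof.
wlog suff H : a c F F' / occurs_at a b F && (F' == overwrite c b F) ->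
    occurs_at c b F' && (F == overwrite a b F').
  by apply/idP/idP; exact: H.
move=> /andP[/forallP aF /eqP ->]; apply/andP; split.
  by apply/forallP => l; rewrite ffunE /= eqxx.
apply/eqP/ffunP => -[l x]; rewrite !ffunE /=.
by case: eqVneq => // ->; exact/eqP.
Qed.

Lemma occurs_prod a b F : (occurs_at a b F)%:R =
  \prod_(l < r) (F (l, b l) == a l)%:R :> R.
Proof.
have [/forallP h|] := boolP (occurs_at a b F).
  by rewrite big1// => l _; rewrite h.
rewrite negb_forall => /existsP[l /negPf h].
by rewrite (bigD1 l)//= h mul0r.
Qed.

Lemma sum_word_prod (h : 'I_r -> 'I_m -> V -> R) :
  \sum_(F : word) \prod_l \prod_x h l x (F (l, x)) = \prod_l \prod_x \sum_y h l x y.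
Proof.
rewrite pair_big /= (bigA_distr_bigA (fun p y => h p.1 p.2 y)).
apply: eq_bigr => F _.
by rewrite (pair_bigA _ (fun l x => h l x (F (l, x)))); apply: eq_bigr => -[].
Qed.

Lemma prod_rows_const (y : R) : \prod_(l < r) y = y ^+ r.
Proof. by rewrite prodr_const card_ord. Qed.

Lemma sum_slots_const (y : R) : \sum_(b : slots) y = m%:R ^+ r * y.
Proof. by rewrite sumr_const card_ffun !card_ord -[LHS]mulr_natl natrX. Qed.

Lemma sum_eq_indic (y0 : V) : \sum_y (y == y0)%:R = 1 :> R.
Proof.
rewrite (bigD1 y0)//= eqxx big1 ?addr0// => y /negPf ->.
by [].
Qed.

Lemma sum_one_card (I : finType) : \sum_(i : I) 1 = #|I|%:R :> R.
Proof. by rewrite sumr_const. Qed.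

Lemma prod_if_eq (x0 : 'I_m) (y : 'I_m -> R) :
  \prod_x (if x == x0 then y x else 1) = y x0.
Proof. by rewrite -big_mkcond /= big_pred1_eq. Qed.

Lemma sum_occurs a b : (0 < m)%N ->
  \sum_F (occurs_at a b F)%:R = (nu%:R ^+ m.-1) ^+ r :> R.
Proof.
move=> m0.
have E1 F : (occurs_at a b F)%:R = \prod_l \prod_(x < m)
    (if x == b l then (F (l, x) == a l)%:R else 1) :> R.
  by rewrite occurs_prod; apply: eq_bigr => l _; rewrite prod_if_eq.
under [LHS]eq_bigr do rewrite E1.
rewrite (sum_word_prod (fun l x y => if x == b l then (y == a l)%:R else 1)).
rewrite -prod_rows_const; apply: eq_bigr => l _.
rewrite (bigD1 (b l))//= eqxx sum_eq_indic mul1r.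
rewrite (eq_bigr (fun=> nu%:R)); last first.
  by move=> x /negPf ->; rewrite sum_one_card.
by rewrite prodr_const cardC1 card_ord.
Qed.

(** The constraints factor over the rows. In a row where b and b' agree the same
    letter is prescribed twice; elsewhere two letters are prescribed, which
    costs one more factor nu. *)
Lemma sum_occurs_both a c b b' : (0 < nu)%N ->
  \sum_F (occurs_at a b F)%:R * (occurs_at c b' F)%:R =
  (nu%:R ^+ m.-1) ^+ r *
  \prod_l (if b' l == b l then (a l == c l)%:R else nu%:R^-1) :> R.
Proof.
move=> nu0.
have nuR : (nu%:R : R) != 0 by rewrite pnatr_eq0 -lt0n.
pose h l x y : R := (if x == b l then (y == a l)%:R else 1) *
  (if x == b' l then (y == c l)%:R else 1).
have E1 F : (occurs_at a b F)%:R * (occurs_at c b' F)%:R =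
    \prod_l \prod_(x < m) h l x (F (l, x)).
  rewrite !occurs_prod -big_split; apply: eq_bigr => l _ /=.
  by rewrite big_split /= !prod_if_eq.
under [LHS]eq_bigr do rewrite E1.
rewrite sum_word_prod -prod_rows_const -big_split.
apply: eq_bigr => l _ /=.
rewrite (bigD1 (b l))//= {1}/h eqxx.
have rest (x : 'I_m) : x != b l -> x != b' l -> \sum_y h l x y = nu%:R.
  move=> /negPf xb /negPf xb'; rewrite -sum_one_card; apply: eq_bigr => y _.
  by rewrite /h xb xb' mulr1.
have [bb'|bb'] := eqVneq (b' l) (b l).
  rewrite [X in _ * X = _](eq_bigr (fun=> nu%:R)); last first.
    by move=> x xb; apply: rest; rewrite ?bb'.
  rewrite prodr_const cardC1 card_ord mulrC; congr (_ * _).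
  have [ac|ac] := eqVneq (a l) (c l).
    rewrite -ac; transitivity (\sum_y (y == a l)%:R : R);
      last exact: sum_eq_indic.
    apply: eq_bigr => y _.
    by case: (y == a l); rewrite ?mulr1 ?mul0r.
  apply: big1 => y _; have [->|_] := eqVneq y (a l); last by rewrite mul0r.
  by rewrite (negPf ac) mulr0.
rewrite [X in X * _](_ : _ = 1) ?mul1r; last first.
  transitivity (\sum_y (y == a l)%:R : R); last exact: sum_eq_indic.
  apply: eq_bigr => y _; by rewrite mulr1.
rewrite (bigD1 (b' l))//= [X in X * _](_ : _ = 1) ?mul1r; last first.
  transitivity (\sum_y (y == c l)%:R : R); last exact: sum_eq_indic.
  apply: eq_bigr => y _; by rewrite /h (negPf bb') eqxx mul1r.
rewrite (eq_bigr (fun=> nu%:R)); last by move=> x /andP[xb xb']; exact: rest.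
rewrite prodr_const.
have -> : #|[pred x | x != b l & x != b' l]| = m.-2.
  have := cardC1 (b l); rewrite card_ord (cardD1 (b' l)) inE /= bb' add1n.
  move=> <- /=; apply: eq_card => x; rewrite !inE andbC.
  by [].
have m1 : (1 < m)%N.
  case: (m) (b l) (b' l) bb' => [[]//|[|//]] [[|//] i] [[|//] j] /=.
  by rewrite /eq_op.
have -> : m.-1 = m.-2.+1 by case: (m) m1 => [|[]].
by rewrite exprSr mulfK.
Qed.

Hypotheses (r0 : (0 < r)%N) (m0 : (0 < m)%N) (nu0 : (0 < nu)%N).
Hypothesis mnu : (m ^ r * nu <= nu ^ r)%N.

Let rho : R := m%:R / nu%:R.

Let nuR : (0 : R) < nu%:R. Proof. by rewrite ltr0n. Qed.

Let rho_ge0 : 0 <= rho. Proof. by rewrite divr_ge0. Qed.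

Let rhoX : rho ^+ r * nu%:R <= 1.
Proof.
rewrite exprMn exprVn mulrAC ler_pdivrMr ?exprn_gt0// mul1r.
by rewrite -!natrX -natrM ler_nat.
Qed.

Let rho_le1 : rho <= 1.
Proof.
rewrite -(expr_le1 r0)//.
apply: le_trans rhoX; rewrite ler_peMr ?exprn_ge0//.
by rewrite (ler_nat _ 1).
Qed.

(** Summation over b' row by row: of the m choices one agrees with b and the
    others contribute 1/nu each, at most rho = m/nu together. *)
Lemma sum_occurs_pair a c :
  \sum_b \sum_F (occurs_at a b F)%:R * (\sum_b' (occurs_at c b' F)%:R) <=
  (m%:R * nu%:R ^+ m.-1) ^+ r * \prod_l ((a l == c l)%:R + rho) :> R.
Proof.
have H b : \sum_F (occurs_at a b F)%:R * (\sum_b' (occurs_at c b' F)%:R) <=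
    (nu%:R ^+ m.-1) ^+ r * \prod_l ((a l == c l)%:R + rho) :> R.
  under [leLHS]eq_bigr do rewrite mulr_sumr.
  rewrite exchange_big /=; under [leLHS]eq_bigr do rewrite sum_occurs_both//.
  rewrite -mulr_sumr ler_wpM2l ?exprn_ge0//.
  rewrite -(bigA_distr_bigA (fun l x => if x == b l then (a l == c l)%:R
    else nu%:R^-1)).
  apply: ler_prod => l _; apply/andP; split.
    by apply: sumr_ge0 => x _; case: ifP => _; rewrite ?invr_ge0.
  rewrite (bigD1 (b l))//= eqxx lerD2l.
  rewrite (eq_bigr (fun=> nu%:R^-1)); last by move=> x /negPf ->.
  rewrite sumr_const cardC1 card_ord -[leLHS]mulr_natl /rho.
  by rewrite ler_pM2r ?invr_gt0// ler_nat leq_pred.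
apply: (@le_trans _ _ (\sum_b ((nu%:R ^+ m.-1) ^+ r *
   \prod_l ((a l == c l)%:R + rho)))); first by apply: ler_sum => b _.
by rewrite sum_slots_const exprMn mulrA.
Qed.

(** If all indicators vanish, the product is rho^r; if one does not, the product
    is at most 2^r, as rho <= 1, and the sum is at least 1. *)
Lemma prod_indic_add (d : 'I_r -> bool) :
  \prod_l ((d l)%:R + rho) <= rho ^+ r + 2 ^+ r * \sum_l (d l)%:R.
Proof.
have [[l dl]|nd] := pselect (exists l, d l).
  apply: (@le_trans _ _ (2 ^+ r * 1)).
    rewrite mulr1 -prod_rows_const; apply: ler_prod => j _.
    rewrite addr_ge0//=; case: (d j); move: rho_le1; rewrite ?mulr1n ?mulr0n; lra.
  apply: ler_wpDl; first exact: exprn_ge0.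
  apply: ler_wpM2l; first exact: exprn_ge0.
  by rewrite (bigD1 l)//= dl lerDl sumr_ge0.
have d0 l : d l = false by apply/negP => dl; apply: nd; exists l.
rewrite [X in _ * X]big1; last by move=> l _; rewrite d0.
rewrite mulr0 addr0 -prod_rows_const le_eqVlt; apply/orP; left.
by apply/eqP; apply: eq_bigr => l _; rewrite d0 add0r.
Qed.

Hypothesis letter_deg : forall y : V,
  (#|[pred e | [exists l, (u e l == y) || (v e l == y)]]| <= t)%N.

Lemma card_edges : (#|E| <= nu * t)%N.
Proof.
apply: (@leq_trans (\sum_(y : V)
    #|[pred e | [exists l, (u e l == y) || (v e l == y)]]|)).
  rewrite -sum1_card.
  under [X in (_ <= X)%N]eq_bigr do rewrite -sum1_card big_mkcond.
  rewrite exchange_big/=; apply: leq_sum => e _.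
  rewrite (bigD1 (u e (Ordinal r0)))//=.
  rewrite ifT ?addn_gt0// inE; apply/existsP.
  by exists (Ordinal r0); rewrite eqxx.
apply: (@leq_trans (\sum_(y : V) t)); first by apply: leq_sum => y _.
by rewrite sum_nat_const.
Qed.

Definition word_deg F : R :=
  \sum_e \sum_b ((occurs_at (u e) b F)%:R + (occurs_at (v e) b F)%:R).

(** A bound, up to the number of occurrences, for the mean degree of words that
    contain a given tuple; doubled because a link is counted at both ends. *)
Definition mean_deg : R := ((1 + r * 2 ^ r) * t)%:R *+ 2.

(** By [prod_indic_add], an edge counts for rho^r and for 2^r at each position
    where it agrees with a; |E| rho^r <= nu t / nu = t, and there are at most
    r t agreements, t for each letter of a. *)
Lemma sum_occurs_family a (s : E -> 'I_r -> V) :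
  (forall e l, s e l = u e l \/ s e l = v e l) ->
  \sum_e \prod_l ((a l == s e l)%:R + rho) <= ((1 + r * 2 ^ r) * t)%:R.
Proof.
move=> suv.
apply: (@le_trans _ _ (\sum_e (rho ^+ r + 2 ^+ r * \sum_l (a l == s e l)%:R))).
  by apply: ler_sum => e _; exact: prod_indic_add.
rewrite big_split /= sumr_const -mulr_sumr exchange_big /=.
rewrite mulnDl mul1n natrD lerD//.
  rewrite -[leLHS]mulr_natr; apply: (@le_trans _ _ (rho ^+ r * (nu * t)%:R)).
    by apply: ler_wpM2l; rewrite ?exprn_ge0// ler_nat card_edges.
  by rewrite natrM mulrA -[leRHS]mul1r ler_wpM2r.
rewrite mulnAC [(_ * 2 ^ r)%N]mulnC natrM natrX ler_wpM2l ?exprn_ge0//.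
apply: (@le_trans _ _ (\sum_(l < r) t%:R)); last first.
  by rewrite sumr_const card_ord -[leLHS]mulr_natl -natrM.
apply: ler_sum => l _; rewrite -natr_sum ler_nat.
apply: leq_trans (letter_deg (a l)).
rewrite -sum1_card [in leqRHS]big_mkcond/=; apply: leq_sum => e _.
have [al|//] := eqVneq (a l) (s e l).
rewrite ifT// inE; apply/existsP; exists l; rewrite al.
by case: (suv e l) => ->; rewrite eqxx ?orbT.
Qed.

Local Notation total := ((m%:R * nu%:R ^+ m.-1) ^+ r : R).

Lemma sum_word_deg a :
  \sum_b \sum_F (occurs_at a b F)%:R * word_deg F <= total * mean_deg.
Proof.
have -> : \sum_b \sum_F (occurs_at a b F)%:R * word_deg F =
   \sum_e \sum_b \sum_F (occurs_at a b F)%:R * (\sum_b' (occurs_at (u e) b' F)%:R) +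
   \sum_e \sum_b \sum_F (occurs_at a b F)%:R * (\sum_b' (occurs_at (v e) b' F)%:R) :> R.
  rewrite -big_split /=.
  under [RHS]eq_bigr do rewrite -big_split /=.
  rewrite [RHS]exchange_big; apply: eq_bigr => b _ /=.
  under [RHS]eq_bigr do rewrite -big_split /=.
  rewrite [RHS]exchange_big; apply: eq_bigr => F _ /=.
  rewrite /word_deg mulr_sumr; apply: eq_bigr => e _.
  by rewrite -mulrDr -big_split.
have fam (s : E -> 'I_r -> V) : (forall e l, s e l = u e l \/ s e l = v e l) ->
    \sum_e \sum_b \sum_F (occurs_at a b F)%:R * (\sum_b' (occurs_at (s e) b' F)%:R)
    <= total * ((1 + r * 2 ^ r) * t)%:R.
  move=> suv; apply: le_trans (ler_wpM2l _ (sum_occurs_family a suv)).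
    by rewrite mulr_sumr; apply: ler_sum => e _; exact: sum_occurs_pair.
  by rewrite exprn_ge0// mulr_ge0// exprn_ge0.
rewrite /mean_deg mulr2n mulrDr lerD//; apply: fam => e l; [by left|by right].
Qed.

(** The factor 4 lets Markov's inequality discard at most a quarter of the links
    on account of either end. *)
Definition light F := word_deg F <= 4 * mean_deg.

Definition light_pairs e : R := \sum_b \sum_F
  (occurs_at (u e) b F && (light F && light (overwrite (v e) b F)))%:R.

Lemma sum_overwrite a c b (f : word -> R) :
  \sum_F (occurs_at a b F)%:R * f (overwrite c b F) =
  \sum_F (occurs_at c b F)%:R * f F.
Proof.
transitivity (\sum_F \sum_F'
    (occurs_at a b F && (F' == overwrite c b F))%:R * f F').
  apply: eq_bigr => F _; rewrite (bigD1 (overwrite c b F))//= eqxx andbT.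
  by rewrite big1 ?addr0// => F' /negPf ->; rewrite andbF mul0r.
rewrite exchange_big; apply: eq_bigr => F' _ /=.
under eq_bigr do rewrite occurs_overwrite.
rewrite (bigD1 (overwrite a b F'))//= eqxx andbT.
by rewrite big1 ?addr0// => F /negPf ->; rewrite andbF mul0r.
Qed.

(** Markov's inequality: the indicator of a bad link of e is at most the sum of
    the degrees of its two ends over 4 mean_deg, and the degree of the second
    end is averaged by reading the link backwards ([sum_overwrite]). *)
Lemma light_pairs_ge e : total / 2 <= light_pairs e.
Proof.
(* An edge contains a letter, so the bound t on its degree is positive. *)
have t0 : (0 < t)%N.
  apply: leq_trans (letter_deg (u e (Ordinal r0))).
  apply/card_gt0P; exists e; rewrite inE.
  by apply/existsP; exists (Ordinal r0); rewrite eqxx.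
have mean0 : 0 < mean_deg.
  by rewrite /mean_deg pmulrn_lgt0// ltr0n muln_gt0 t0.
have wd0 F : 0 <= word_deg F.
  by apply: sumr_ge0 => e' _; apply: sumr_ge0 => b _; rewrite addr_ge0.
have tot : \sum_b \sum_F (occurs_at (u e) b F)%:R = total.
  under eq_bigr do rewrite sum_occurs//.
  by rewrite sum_slots_const exprMn.
have pt b F : (occurs_at (u e) b F)%:R - (occurs_at (u e) b F &&
     (light F && light (overwrite (v e) b F)))%:R <=
   (4 * mean_deg)^-1 * ((occurs_at (u e) b F)%:R * word_deg F) +
   (4 * mean_deg)^-1 * ((occurs_at (u e) b F)%:R * word_deg (overwrite (v e) b F)).
  rewrite -mulrDr -mulrDr mulrC ler_pdivlMr ?mulr_gt0//.
  case: (occurs_at _ _ _); last by rewrite /= subr0 !mul0r.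
  rewrite /= !mul1r; have [l1|] := boolP (light F); last first.
    rewrite /light -ltNge => h; rewrite subr0 mul1r.
    by rewrite (le_trans (ltW h))// lerDl.
  have [l2|] := boolP (light (overwrite (v e) b F)); last first.
    rewrite /light -ltNge => h; rewrite subr0 mul1r.
    by rewrite (le_trans (ltW h))// lerDr.
  by rewrite /= subrr mul0r addr_ge0.
have : total - light_pairs e <= (4 * mean_deg)^-1 * (total * mean_deg) +
   (4 * mean_deg)^-1 * (total * mean_deg).
  rewrite -{1}tot -sumrB.
  apply: (@le_trans _ _ (\sum_b ((4 * mean_deg)^-1 *
     (\sum_F (occurs_at (u e) b F)%:R * word_deg F) + (4 * mean_deg)^-1 *
     (\sum_F (occurs_at (v e) b F)%:R * word_deg F)))).
    apply: ler_sum => b _; rewrite -sumrB -(sum_overwrite (u e) (v e)).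
    rewrite !mulr_sumr -big_split; apply: ler_sum => F _; exact: pt.
  rewrite big_split /= -!mulr_sumr lerD// ler_wpM2l ?sum_word_deg//.
  - by rewrite invr_ge0 mulr_ge0// ltW.
  - by rewrite invr_ge0 mulr_ge0// ltW.
have -> : (4 * mean_deg)^-1 * (total * mean_deg) = total / 4.
  have : mean_deg != 0 by rewrite gt_eqF.
  by move: (mean_deg) total => x y x0; field.
lra.
Qed.

(** Pruning leaves each edge with its own number of links; this weight makes
    their total the same for all edges, so that the form is a multiple of the
    unweighted sum over the edges. *)
Definition edge_weight e : R := total / light_pairs e.

Lemma total_gt0 : 0 < total.
Proof. by rewrite exprn_gt0// mulr_gt0 ?exprn_gt0// ltr0n. Qed.

Lemma light_pairs_gt0 e : 0 < light_pairs e.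
Proof. by apply: lt_le_trans (light_pairs_ge e); rewrite divr_gt0// total_gt0. Qed.

Lemma edge_weight_ge0 e : 0 <= edge_weight e.
Proof. by rewrite divr_ge0// ltW// ?total_gt0// light_pairs_gt0. Qed.

Lemma edge_weight_le2 e : edge_weight e <= 2.
Proof.
rewrite ler_pdivrMr ?light_pairs_gt0// [leRHS]mulrC.
by rewrite -ler_pdivrMr// light_pairs_ge.
Qed.

Definition kikuchi_entry F F' : R := \sum_e \sum_b edge_weight e *
  (occurs_at (u e) b F && (F' == overwrite (v e) b F) &&
   (light F && light F'))%:R.

Lemma kikuchi_entry_ge0 F F' : 0 <= kikuchi_entry F F'.
Proof.
apply: sumr_ge0 => e _; apply: sumr_ge0 => b _.
by rewrite mulr_ge0// edge_weight_ge0.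
Qed.

Lemma mean_deg_ge0 : 0 <= mean_deg.
Proof. by rewrite /mean_deg mulrn_wge0. Qed.

Lemma sum_light_occurs (s : E -> 'I_r -> V) F :
  (forall b, \sum_e (occurs_at (s e) b F)%:R <=
     \sum_e ((occurs_at (u e) b F)%:R + (occurs_at (v e) b F)%:R : R)) ->
  \sum_e \sum_b edge_weight e * (occurs_at (s e) b F && light F)%:R <=
  8 * mean_deg.
Proof.
move=> suv; have [lF|_] := boolP (light F); last first.
  rewrite big1 ?mulr_ge0 ?mean_deg_ge0// => e _; rewrite big1// => b _.
  by rewrite andbF mulr0.
apply: (@le_trans _ _ (2 * word_deg F)); last first.
  by move: lF; rewrite /light; lra.
rewrite /word_deg exchange_big [in leRHS]exchange_big mulr_sumr.
apply: ler_sum => b _.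
apply: (@le_trans _ _ (2 * \sum_e (occurs_at (s e) b F)%:R)).
  rewrite mulr_sumr; apply: ler_sum => e _; rewrite andbT.
  by rewrite ler_wpM2r// edge_weight_le2.
by rewrite ler_wpM2l.
Qed.

Lemma kikuchi_row_sum F : \sum_F' kikuchi_entry F F' <= 8 * mean_deg.
Proof.
apply: (@le_trans _ _ (\sum_e \sum_b
    edge_weight e * (occurs_at (u e) b F && light F)%:R)).
  rewrite exchange_big; apply: ler_sum => e _ /=.
  rewrite exchange_big; apply: ler_sum => b _ /=.
  rewrite -mulr_sumr ler_wpM2l ?edge_weight_ge0//.
  rewrite (bigD1 (overwrite (v e) b F))//= eqxx andbT big1 ?addr0; last first.
    by move=> F' /negPf ->; rewrite andbF.
  by rewrite ler_nat; case: (occurs_at _ _ _); case: (light F) => //=; case: (light _).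
apply: sum_light_occurs => b; apply: ler_sum => e _.
by rewrite lerDl.
Qed.

Lemma kikuchi_col_sum F' : \sum_F kikuchi_entry F F' <= 8 * mean_deg.
Proof.
apply: (@le_trans _ _ (\sum_e \sum_b
    edge_weight e * (occurs_at (v e) b F' && light F')%:R)).
  rewrite exchange_big; apply: ler_sum => e _ /=.
  rewrite exchange_big; apply: ler_sum => b _ /=.
  rewrite -mulr_sumr ler_wpM2l ?edge_weight_ge0//.
  under eq_bigr do rewrite occurs_overwrite.
  rewrite (bigD1 (overwrite (u e) b F'))//= eqxx andbT big1 ?addr0; last first.
    by move=> F /negPf ->; rewrite andbF.
  by rewrite ler_nat; case: (occurs_at _ _ _); case: (light F') => //=; case: (light _).
apply: sum_light_occurs => b; apply: ler_sum => e _.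
by rewrite lerDr.
Qed.

(** Letters outside the slots occur in both words, and their signs cancel. *)
Lemma char_overwrite (X : V -> R) a c b F : (forall y, X y ^+ 2 = 1) ->
  occurs_at a b F ->
  (\prod_p X (F p)) * (\prod_p X (overwrite c b F p)) =
  (\prod_l X (a l)) * \prod_l X (c l).
Proof.
move=> X2 /forallP aF; rewrite -!big_split /=.
rewrite (eq_bigr (fun p => X (F (p.1, p.2)) * X (overwrite c b F (p.1, p.2))));
  last by case.
rewrite -(pair_bigA _ (fun l x => X (F (l, x)) * X (overwrite c b F (l, x))))/=.
apply: eq_bigr => l _; rewrite (bigD1 (b l))//= ffunE /= eqxx (eqP (aF l)).
by rewrite big1 ?mulr1// => x /negPf xb; rewrite ffunE /= xb -expr2 X2.
Qed.

Lemma kikuchi_form (X : V -> R) : (forall y, X y ^+ 2 = 1) ->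
  \sum_(F : word) \sum_(F' : word)
    (\prod_p X (F p)) * kikuchi_entry F F' * (\prod_p X (F' p)) =
  total * \sum_e (\prod_l X (u e l)) * \prod_l X (v e l).
Proof.
move=> X2.
transitivity (\sum_e \sum_b \sum_F edge_weight e *
    (occurs_at (u e) b F && (light F && light (overwrite (v e) b F)))%:R *
    ((\prod_l X (u e l)) * \prod_l X (v e l))).
  transitivity (\sum_e \sum_b \sum_(F : word) \sum_(F' : word)
      (\prod_p X (F p)) * (edge_weight e *
  (occurs_at (u e) b F && (F' == overwrite (v e) b F) &&
   (light F && light F'))%:R) * (\prod_p X (F' p))).
    rewrite exchange_big /=.
    under [RHS]eq_bigr do rewrite exchange_big /=.
    rewrite [RHS]exchange_big /= [LHS]exchange_big /=.
    apply: eq_bigr => F _.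
    under [RHS]eq_bigr do rewrite exchange_big /=.
    rewrite [RHS]exchange_big /=; apply: eq_bigr => F' _.
    rewrite /kikuchi_entry mulr_sumr mulr_suml; apply: eq_bigr => e _.
    by rewrite mulr_sumr mulr_suml.
  apply: eq_bigr => e _; apply: eq_bigr => b _; apply: eq_bigr => F _.
  rewrite [LHS](bigD1 (overwrite (v e) b F))//= eqxx andbT.
  rewrite [X in _ + X]big1 ?addr0; last first.
    by move=> F' /negPf ->; rewrite andbF mulr0 mulr0 mul0r.
  have [oc|] := boolP (occurs_at (u e) b F); last by rewrite /= !mulr0 !mul0r.
  by rewrite -(char_overwrite _ X2 oc); ring.
rewrite mulr_sumr; apply: eq_bigr => e _.
under [LHS]eq_bigr do rewrite -mulr_suml -mulr_sumr.
rewrite -mulr_suml -mulr_sumr -/(light_pairs e) /edge_weight.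
by rewrite divfK// gt_eqF// light_pairs_gt0.
Qed.

(** Adding the transpose doubles the quadratic form and at most doubles the row
    sums, column sums being bounded in the same way, and provides the symmetry
    required by [qform_exp_le_trace]. *)
Lemma kikuchi_matrix : exists A : 'M[R]_#|{: word}|,
  [/\ A^T = A, forall i j, 0 <= A i j,
      forall i, \sum_j A i j <= 32 * ((1 + r * 2 ^ r) * t)%:R &
      forall X : V -> R, (forall y, X y ^+ 2 = 1) ->
        qform A (fun i => \prod_p X (enum_val i p)) =
        2 * total * \sum_e (\prod_l X (u e l)) * \prod_l X (v e l)].
Proof.
have reindex_word (f : word -> R) : \sum_(i < #|{: word}|) f (enum_val i) = \sum_F f F.
  by rewrite -(@big_enum_val _ _ _ _ _ f); apply: eq_bigl.
pose A : 'M[R]_#|{: word}| := \matrix_(i, j)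
  (kikuchi_entry (enum_val i) (enum_val j) +
   kikuchi_entry (enum_val j) (enum_val i)).
exists A; split.
- by apply/matrixP => i j; rewrite !mxE addrC.
- by move=> i j; rewrite mxE addr_ge0// kikuchi_entry_ge0.
- move=> i; under eq_bigr do rewrite mxE.
  rewrite big_split /= (reindex_word (kikuchi_entry (enum_val i))).
  rewrite (reindex_word (kikuchi_entry ^~ (enum_val i))).
  have := kikuchi_row_sum (enum_val i).
  have := kikuchi_col_sum (enum_val i).
  by rewrite /mean_deg; lra.
- move=> X X2.
  pose f (F : word) := \prod_p X (F p).
  pose K F F' := kikuchi_entry F F' + kikuchi_entry F' F.
  have -> : qform A (fun i => f (enum_val i)) =
      \sum_(F : word) \sum_(F' : word) f F * K F F' * f F'.
    rewrite -reindex_word; apply: eq_bigr => i _.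
    rewrite -reindex_word; apply: eq_bigr => j _.
    by rewrite mxE.
  rewrite -mulrA -kikuchi_form// mulr_natl mulr2n.
  rewrite [X in _ = _ + X]exchange_big -big_split; apply: eq_bigr => F _ /=.
  rewrite -big_split; apply: eq_bigr => F' _ /=.
  by rewrite /K /f; ring.
Qed.

End kikuchi.

(** * Multilinear polynomials on the Boolean cube *)

Section multilinear_forms.
Variable R : realType.

(** A nonempty list of at most 2r variables is spread over 2r positions; the
    positions left over repeat one of the variables. *)
Lemma nonzero_vars_slots n (m : mpoly.multinom n) r :
  m != mpoly.mnm0 -> (mpoly.mdeg m <= r.*2)%N ->
  exists q : 'I_r * bool -> 'I_n, forall j, (m j != 0%N) = [exists p, q p == j].
Proof.
move=> m0 mr; pose s := [seq j <- enum 'I_n | m j != 0%N].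
have mem_s j : (j \in s) = (m j != 0%N) by rewrite mem_filter mem_enum andbT.
have [j0 j0s] : exists j0, j0 \in s.
  have [/forallP z|] := boolP [forall j, m j == 0%N].
    by case/eqP: m0; apply/mpoly.mnmP => j; rewrite mpoly.mnm0E (eqP (z j)).
  by rewrite negb_forall => /existsP[j mj]; exists j; rewrite mem_s.
have size_s : (size s <= r.*2)%N.
  apply: leq_trans mr; rewrite mpoly.mdegE size_filter -sum1_count big_mkcond.
  rewrite big_enum /=; apply: leq_sum => j _.
  by case: ifP => // mj; rewrite lt0n.
exists (fun p : 'I_r * bool => nth j0 s (p.1 + (if p.2 then r else 0)))%N => j.
rewrite -mem_s; apply/idP/existsP => [js|[p /eqP <-]]; last first.
  set i := (_ + _)%N; have [?|?] := ltnP i (size s); first exact: mem_nth.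
  by rewrite nth_default.
have is2 : (index j s < r.*2)%N by rewrite (leq_trans _ size_s)// index_mem.
have [ir|ri] := ltnP (index j s) r.
  by exists (Ordinal ir, false); rewrite /= addn0 nth_index.
have ir : (index j s - r < r)%N by rewrite ltn_subLR// addnn.
by exists (Ordinal ir, true); rewrite /= subnK// nth_index.
Qed.

(** A position outside S receives the sign 1, so that the sum over S expands
    prod (1 + y) over the positions. *)
Definition sign_letter n r (x : {ffun 'I_n -> bool})
    (S : {ffun 'I_r * bool -> bool}) (c : 'I_n * ('I_r * bool)) : R :=
  if S c.2 then (-1) ^+ (~~ x c.1) else 1.

Lemma sign_letter_sqr n r (x : {ffun 'I_n -> bool}) S c :
  @sign_letter n r x S c ^+ 2 = 1.
Proof. by rewrite /sign_letter; case: ifP => _; rewrite ?expr1n ?sqrr_sign. Qed.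

(** On the cube, exponents and repetitions of a variable do not matter, and
    x = (1 + y)/2 for the sign y = 2x - 1. *)
Lemma monomial_average n r (x : {ffun 'I_n -> bool}) (m : mpoly.multinom n)
    (q : 'I_r * bool -> 'I_n) :
  (forall j, (m j != 0%N) = [exists p, q p == j]) ->
  \prod_j (x j)%:R ^+ m j = 2 ^- r.*2 *
    \sum_S (\prod_l sign_letter x S (q (l, false), (l, false))) *
           \prod_l sign_letter x S (q (l, true), (l, true)) :> R.
Proof.
move=> qm.
have -> : \prod_j (x j)%:R ^+ m j = \prod_p (x (q p))%:R :> R.
  have [/existsP[p /negPf xp]|] := boolP [exists p, ~~ x (q p)].
    rewrite (bigD1 (q p))//= [RHS](bigD1 p)//= xp !mul0r expr0n.
    have -> : (m (q p) == 0%N) = false.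
      apply/negbTE; rewrite qm; apply/existsP; by exists p.
    by rewrite mul0r.
  rewrite negb_exists => /forallP h.
  rewrite [RHS]big1; last by move=> p _; have := h p; rewrite negbK => ->.
  apply: big1 => j _; have [->|] := eqVneq (m j) 0%N; first by rewrite expr0.
  rewrite qm => /existsP[p /eqP <-].
  by have := h p; rewrite negbK => ->; rewrite expr1n.
have -> : \prod_p (x (q p))%:R = \prod_(p : 'I_r * bool)
    (2^-1 * \sum_(s : bool) if s then (-1) ^+ (~~ x (q p)) else 1) :> R.
  apply: eq_bigr => p _; rewrite big_bool /=; case: (x (q p)) => /=.
    by rewrite expr0 -[1 + 1]/(2%:R) mulVf// pnatr_eq0.
  by rewrite expr1 addNr mulr0.
rewrite big_split /= prodr_const card_prod card_ord card_bool muln2 exprVn.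
congr (_ * _); rewrite bigA_distr_bigA; apply: eq_bigr => S _.
pose f l b : R := if S (l, b) then (-1) ^+ (~~ x (q (l, b))) else 1.
transitivity (\prod_p f p.1 p.2); first by apply: eq_bigr => -[].
rewrite -(pair_bigA _ f).
rewrite -big_split; apply: eq_bigr => l _ /=.
by rewrite big_bool /f /sign_letter /= mulrC.
Qed.

Lemma card_tnth_count (T : Type) (s : seq T) (P : pred T) :
  #|[pred i : 'I_(size s) | P (tnth (in_tuple s) i)]| = count P s.
Proof.
rewrite -sum1_count big_tnth -sum1_card.
by apply: eq_bigl.
Qed.

(** Letters carry their position, so a letter lies in an edge only if its
    variable lies in the monomial: the multiplicity t bounds the degree of
    letters even though variables may be repeated. *)
Lemma multilinear_edges n (psi : mpoly.mpoly n R) r t :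
  zero_one_coeffs psi -> degree_le r.*2 psi ->
  has_multiplicity t psi ->
  exists (E : finType) (u v : E -> 'I_r -> 'I_n * ('I_r * bool)),
    (forall y, (#|[pred e | [exists l, (u e l == y) || (v e l == y)]]| <= t)%N) /\
    forall x : {ffun 'I_n -> bool},
      mpoly.meval (fun j => (x j)%:R) psi = mpoly.meval (fun=> 0) psi +
      2 ^- r.*2 * \sum_S \sum_e (\prod_l sign_letter x S (u e l)) *
           \prod_l sign_letter x S (v e l).
Proof.
move=> zo dg mu.
pose s := [seq m <- mpoly.msupp psi | m != mpoly.mnm0].
pose mono (e : 'I_(size s)) := tnth (in_tuple s) e.
have mono_s e : mono e != mpoly.mnm0 /\ mono e \in mpoly.msupp psi.
  by have := mem_tnth e (in_tuple s); rewrite mem_filter => /andP[].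
have slots (e : 'I_(size s)) : exists q : 'I_r * bool -> 'I_n,
    forall j, (mono e j != 0%N) = [exists p, q p == j].
  have [m0 mpsi] := mono_s e; apply: nonzero_vars_slots => //.
  by have := mpoly.msize_mdeg_lt mpsi => /leq_trans/(_ dg).
have [q hq] := choice slots.
exists 'I_(size s).
exists (fun e l => (q e (l, false), (l, false))).
exists (fun e l => (q e (l, true), (l, true))); split.
  move=> [j p]; apply: leq_trans (mu j).
  apply: (@leq_trans #|[pred e | mono e j != 0%N]|).
    apply: subset_leq_card; apply/fintype.subsetP => e; rewrite !inE => /existsP[l].
    by rewrite !xpair_eqE hq => /orP[] /andP[? _]; apply/existsP;
      [exists (l, false)|exists (l, true)].
  rewrite (card_tnth_count s (fun m : mpoly.multinom n => m j != 0%N)).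
  by rewrite count_filter; apply: sub_count => m /andP[].
move=> x.
have coeff1 m : m \in mpoly.msupp psi -> mpoly.mcoeff m psi = 1.
  by rewrite mpoly.mcoeff_msupp; case: (zo m) => ->; rewrite ?eqxx.
have evalE y : mpoly.meval y psi = \sum_(m <- s) \prod_j y j ^+ m j +
    \sum_(m <- mpoly.msupp psi | m == mpoly.mnm0) \prod_j y j ^+ m j.
  rewrite mpoly.mevalE big_filter (bigID (fun m => m == mpoly.mnm0)) addrC /=.
  by congr (_ + _); rewrite big_seq_cond [RHS]big_seq_cond; apply: eq_bigr
    => m /andP[mp _]; rewrite coeff1// mul1r.
have zero_s : \sum_(m <- s) \prod_(j < n) (0 : R) ^+ m j = 0.
  rewrite big_seq; apply: big1 => m; rewrite mem_filter => /andP[m0 _].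
  have [/forallP z|] := boolP [forall j, m j == 0%N].
    by case/eqP: m0; apply/mpoly.mnmP => j; rewrite mpoly.mnm0E (eqP (z j)).
  rewrite negb_forall => /existsP[j /negPf mj].
  by rewrite (bigD1 j)//= expr0n mj mul0r.
rewrite !evalE zero_s add0r addrC; congr (_ + _).
  apply: eq_bigr => m /eqP ->; apply: eq_bigr => j _.
  by rewrite mpoly.mnm0E !expr0.
rewrite exchange_big mulr_sumr big_tnth; apply: eq_bigr => e _ /=.
exact: monomial_average (hq e).
Qed.

End multilinear_forms.

(** * Width of the image of the cube *)

Section kikuchi_width.
Variable R : realType.

(** The modulus of an average is at most the largest modulus of its terms. *)
Lemma expr_average_le (I : finType) (i0 : I) (z : I -> R) (B : R) q :
  ~~ odd q -> (forall i, z i ^+ q <= B) ->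
  (#|I|%:R^-1 * \sum_i z i) ^+ q <= B.
Proof.
move=> evq zB.
have [i _ zi] := @arg_maxP _ _ _ i0 xpredT (fun i => `|z i|) isT.
apply: le_trans (zB i).
have normq (y : R) : y ^+ q = `|y| ^+ q.
  by rewrite -normrX ger0_norm// exprn_even_ge0.
rewrite (normq (_ * _)) (normq (z i)); apply: lerXn2r; rewrite ?nnegrE//.
rewrite normrM normfV normr_nat.
have I0 : (0 : R) < #|I|%:R by rewrite ltr0n; apply/card_gt0P; exists i0.
rewrite ler_pdivrMl// (le_trans (ler_norm_sum _ _ _))//.
rewrite mulr_natl -sumr_const; apply: ler_sum => j _; exact: zi.
Qed.

Lemma image_boolean_cube n k (psi : 'I_k -> mpoly.mpoly n R) :
  poly_map psi @` boolean_cube R n =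
  [set (\row_i mpoly.meval (fun j => (x j)%:R) (psi i) : 'rV[R]_k)
     | x in [set: {ffun 'I_n -> bool}]].
Proof.
apply/seteqP; split => [_ [x xb <-]|_ [x _ <-]].
  exists [ffun j => x 0 j == 1] => //; apply/rowP => i; rewrite !mxE.
  congr (mpoly.meval _ _); apply/funext => j; rewrite ffunE.
  by case: (xb j) => ->; rewrite ?eqxx// eq_sym oner_eq0.
exists (\row_j (x j)%:R).
  by move=> j; rewrite mxE; case: (x j); [right|left].
apply/rowP => i; rewrite !mxE.
by congr (mpoly.meval _ _); apply/funext => j; rewrite mxE.
Qed.

(** The point x = 0 of the cube is the reference point of
    [gaussian_width_le_moment]. Sign vectors have squared norm N, hence the
    factor N / (2 total) for each of the q copies of the form. *)
Lemma kikuchi_gaussian_width n k r m t h (psi : 'I_k -> mpoly.mpoly n R)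
    (a l N total tau : R) (q := (2 ^ h.+1)%N) (nu := (n * (r * 2))%N) :
  (0 < n)%N -> (0 < r)%N -> (0 < m)%N -> (m ^ r * nu <= nu ^ r)%N ->
  (forall i, [/\ zero_one_coeffs (psi i), degree_le r.*2 (psi i) &
     has_multiplicity t (psi i)]) ->
  0 < a -> 0 < l ->
  N = nu%:R ^+ (r * m) -> total = (m%:R * nu%:R ^+ m.-1) ^+ r ->
  tau = 32 * ((1 + r * 2 ^ r) * t)%:R ->
  (N / (2 * total)) ^+ q *
    (N * tau ^+ q * (q`!%:R / l ^+ q * (expR (k%:R * (l ^+ 2 / 2)) *+ 2)))
    <= a ^+ q ->
  (gaussian_width (poly_map psi @` boolean_cube R n) <= (a *+ 2)%:E)%E.
Proof.
move=> n0 r0 m0 mnu psiP a0 l0 NE totalE tauE bound.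
pose V := ('I_n * ('I_r * bool))%type.
have VE : #|{: V}| = nu by rewrite !card_prod !card_ord card_bool.
pose word := {ffun 'I_r * 'I_m -> V}.
have wordE : (#|{: word}|%:R : R) = N.
  by rewrite NE card_ffun VE card_prod !card_ord natrX.
have nu0 : (0 < nu)%N by rewrite !muln_gt0 n0 r0.
have total0 : 0 < total.
  by rewrite totalE exprn_gt0// mulr_gt0 ?exprn_gt0// ltr0n.
have tau0 : 0 <= tau by rewrite tauE mulr_ge0.
have N0 : 0 <= N by rewrite NE exprn_ge0.
have matrices i : exists A : 'M[R]_#|{: word}|,
    [/\ A^T = A, forall x y, 0 <= A x y, forall x, \sum_y A x y <= tau &
     forall x : {ffun 'I_n -> bool},
      mpoly.meval (fun j => (x j)%:R) (psi i) =
      mpoly.meval (fun=> 0) (psi i) + 2 ^- r.*2 * \sum_S (2 * total)^-1 *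
        qform A (fun F => \prod_p sign_letter R x S (enum_val F p))].
  have [zo dg mu] := psiP i.
  have [E [u [v [deg form]]]] := multilinear_edges zo dg mu.
  have nuV : (0 < #|{: V}|)%N by rewrite VE.
  have mnuV : (m ^ r * #|{: V}| <= #|{: V}| ^ r)%N by rewrite VE.
  have [A [sA A0 At Aq]] := kikuchi_matrix R r0 m0 nuV mnuV deg.
  exists A; split => //; first by move=> x; rewrite tauE; exact: At.
  move=> x; rewrite form; congr (_ + _ * _); apply: eq_bigr => S _.
  rewrite Aq; last exact: sign_letter_sqr.
  by rewrite VE -totalE mulKf// mulf_neq0// gt_eqF.
have [A HA] := choice matrices.
rewrite image_boolean_cube.
apply: (@gaussian_width_le_moment R k _ _ [ffun=> false] q a l
  ((N / (2 * total)) ^+ q) (N * tau ^+ q)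
  (fun w => \tr (\prod_(j <- w) A j))) => //.
- by rewrite exprn_ge0// divr_ge0// mulr_ge0// ltW.
- by rewrite mulr_ge0// exprn_ge0.
- by rewrite /q expnS mul2n odd_double.
- by rewrite /q expn_gt0.
- move=> w sw; rewrite -wordE -sw; apply: trace_prod_bounds => //.
  + by move=> i; have [] := HA i.
  + by move=> i; have [] := HA i.
move=> x y; rewrite -trace_exp_sum_words.
set G := \sum_i y i *: A i.
pose z S := (2 * total)^-1 *
  qform G (fun F => \prod_p sign_letter R x S (enum_val F p)).
have -> : \sum_(j < k) ((\row_i mpoly.meval (fun j => (x j)%:R) (psi i)) 0 j -
     (\row_i mpoly.meval (fun j => ([ffun=> false] j)%:R) (psi i)) 0 j) * y j =
   #|{: {ffun 'I_r * bool -> bool}}|%:R^-1 * \sum_S z S.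
  have qformG w : qform G w = \sum_i y i * qform (A i) w.
    rewrite /qform; under [RHS]eq_bigr do rewrite mulr_sumr.
    rewrite [RHS]exchange_big; apply: eq_bigr => F _ /=.
    under [RHS]eq_bigr do rewrite mulr_sumr.
    rewrite [RHS]exchange_big; apply: eq_bigr => F' _ /=.
    rewrite /G summxE mulr_sumr mulr_suml; apply: eq_bigr => i _.
    by rewrite mxE; ring.
  rewrite card_ffun card_prod card_ord card_bool muln2 natrX.
  under [in RHS]eq_bigr do rewrite /z qformG mulr_sumr.
  rewrite exchange_big mulr_sumr; apply: eq_bigr => i _ /=.
  have [_ _ _ evalx] := HA i.
  have f0 : (fun j : 'I_n => ([ffun=> false] j : bool)%:R) = (fun=> 0) :> ('I_n -> R).
    by apply/funext => j; rewrite ffunE.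
  rewrite !mxE f0 evalx.
  rewrite addrAC subrr add0r mulrC mulrCA; congr (_ * _).
  by rewrite mulr_sumr; apply: eq_bigr => S _; rewrite mulrCA.
apply: expr_average_le; first exact: [ffun=> false].
  by rewrite /q expnS mul2n odd_double.
move=> S; rewrite /z exprMn exprMn mulrAC -wordE exprVn.
have sG : G^T = G.
  rewrite /G raddf_sum; apply: eq_bigr => i _ /=.
  by rewrite linearZ/=; have [-> _ _ _] := HA i.
rewrite -exprVn mulrC; apply: ler_wpM2r.
  by rewrite exprn_ge0// invr_ge0 mulr_ge0// ltW.
apply: le_trans (qform_exp_le_trace _ h sG) _.
rewrite -/q le_eqVlt; apply/orP; left; apply/eqP; congr (_ ^+ _ * _).
rewrite (eq_bigr (fun=> 1)); first by rewrite sumr_const card_ord.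
move=> F _; rewrite -prodrXl; apply: big1 => p _; exact: sign_letter_sqr.
Qed.

End kikuchi_width.

(** * Choice of the parameters *)

Lemma leq_fact_expn n : (n`! <= n ^ n)%N.
Proof.
elim: n => // n IH; rewrite factS expnS leq_mul2l /= (leq_trans IH)//.
by case: n {IH} => // n; rewrite leq_exp2r.
Qed.

(** The integer part m of nu^(1-1/r), described without roots: at most
    nu^(1-1/r) keeps the mean degree bounded, and at least half of it gives
    (nu/m)^r = O(nu). *)
Lemma block_length_exists (nu r : nat) : (0 < nu)%N -> (0 < r)%N ->
  exists m, [/\ (0 < m)%N, (m ^ r * nu <= nu ^ r)%N &
                (nu ^ r <= (2 * m) ^ r * nu)%N].
Proof.
move=> nu0 r0; pose P m := (m ^ r <= nu ^ r.-1)%N.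
have P1 : exists m, P m by exists 1%N; rewrite /P exp1n expn_gt0 nu0.
have Pub m : P m -> (m <= nu ^ r.-1)%N.
  case: m => // m; apply: leq_trans; rewrite -{1}(expn1 m.+1).
  by rewrite leq_pexp2l.
case: (ex_maxnP P1 Pub) => m Pm mmax.
have m0 : (0 < m)%N by apply: mmax; rewrite /P exp1n expn_gt0 nu0.
have nuE : (nu ^ r = nu ^ r.-1 * nu)%N by rewrite -expnSr prednK.
exists m; split => //; first by rewrite nuE leq_mul2r; apply/orP; right.
rewrite nuE leq_mul2r; apply/orP; right.
have : ~~ P m.+1 by apply/negP => /mmax; rewrite ltnn.
rewrite /P -ltnNge => /ltnW/leq_trans; apply.
by rewrite leq_exp2r// mul2n -addnn -addn1 leq_add2l.
Qed.

Section parameters.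
Variable R : realType.

(** The exponent of the trace moment must be a power of 2. *)
Lemma power2_near (X : R) : 1 <= X ->
  exists h : nat, X <= (2 ^ h.+1)%:R <= 4 * X.
Proof.
move=> X1; pose P h := X <= (2 ^ h)%:R.
have exP : exists h, P h.
  exists (Num.truncn X).+1; rewrite /P (@le_trans _ _ (Num.truncn X).+1%:R)//.
    by rewrite ltW// truncnS_gt// (le_trans _ X1).
  by rewrite ler_nat ltnW// ltn_expl.
case: (ex_minnP exP) => h Ph hmin; exists h; apply/andP; split.
  by rewrite (le_trans Ph)// ler_nat leq_exp2l.
case: h Ph hmin => [|h] Ph hmin; first by rewrite expn1; lra.
have : ~~ P h by apply/negP => /hmin; rewrite ltnn.
rewrite /P -ltNge => hX.
by rewrite 2!expnS !natrM; lra.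
Qed.

(** The choice l = q/s, with s = sqrt (k q), makes k l^2 = q, so that the moment
    generating function contributes e^(q/2), while q!/l^q <= s^q. *)
Lemma moment_bound (rho N tau s : R) (k q : nat) :
  (0 < k)%N -> (0 < q)%N -> 0 <= rho -> 0 <= tau -> 0 <= N -> N <= expR q%:R ->
  s = Num.sqrt (k%:R * q%:R) ->
  (rho / 2) ^+ q * (N * tau ^+ q *
    (q`!%:R / (q%:R / s) ^+ q *
     (expR (k%:R * ((q%:R / s) ^+ 2 / 2)) *+ 2)))
  <= (rho * tau * s * expR 2) ^+ q.
Proof.
move=> k0 q0 rho0 tau0 N0 Nq sE.
have qR : (0 : R) < q%:R by rewrite ltr0n.
have kR : (0 : R) < k%:R by rewrite ltr0n.
have s2 : s ^+ 2 = k%:R * q%:R by rewrite sE sqr_sqrtr// mulr_ge0.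
have s0 : 0 < s by rewrite sE sqrtr_gt0 mulr_gt0.
have e1 : k%:R * ((q%:R / s) ^+ 2 / 2) = q%:R / 2 :> R.
  rewrite exprMn exprVn s2; field; by rewrite !gt_eqF.
rewrite e1.
have e2 : expR (q%:R / 2) *+ 2 <= 2 ^+ q * expR q%:R :> R.
  rewrite -[leLHS]mulr_natl; apply: ler_pM; rewrite ?expR_ge0//.
    by rewrite -[leLHS]expr1 ler_weXn2l// ler1n.
  by rewrite ler_expR; lra.
have e3 : q`!%:R / (q%:R / s) ^+ q <= s ^+ q.
  rewrite ler_pdivrMr ?exprn_gt0 ?divr_gt0// -exprMn mulrCA divff ?gt_eqF// mulr1.
  rewrite -natrX ler_nat.
  exact: leq_fact_expn.
have qe : expR (q%:R) = expR 1 ^+ q :> R by rewrite -expRM_natl mulr1.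
have e4 : expR 2 = expR 1 * expR 1 :> R by rewrite -expRD.
apply: (@le_trans _ _ ((rho / 2) ^+ q * (expR 1 ^+ q * tau ^+ q *
    (s ^+ q * (2 ^+ q * expR 1 ^+ q))))); last first.
  rewrite le_eqVlt -!exprMn e4; apply/orP; left; apply/eqP; congr (_ ^+ q).
  by field.
rewrite -qe; apply: ler_wpM2l; first by rewrite exprn_ge0// divr_ge0.
have f0 : 0 <= q`!%:R / (q%:R / s) ^+ q.
  by rewrite divr_ge0// exprn_ge0// divr_ge0// ltW.
have g0 : 0 <= expR (q%:R / 2) *+ 2 :> R by rewrite mulrn_wge0// expR_ge0.
apply: ler_pM.
- by rewrite mulr_ge0// exprn_ge0.
- exact: mulr_ge0.
- by rewrite ler_wpM2r// exprn_ge0.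
- exact: ler_pM.
Qed.

(** In dimension 0 the required bound is 0. *)
Lemma gaussian_width_dim0 (T : set 'rV[R]_0) : T !=set0 ->
  (gaussian_width T = 0)%E.
Proof.
move=> [x Tx]; rewrite /gaussian_width; apply: integral0_eq => g _.
rewrite (_ : [set _ | _ in T] = [set 0%E]); first exact: ereal_sup1.
apply/seteqP; split => [_ [y _ <-]|_ ->]; first by rewrite big_ord0.
by exists x => //; rewrite big_ord0.
Qed.

Lemma ln_alphabet_ge1 n r : (1 < n)%N -> (0 < r)%N ->
  1 <= ln ((n * (r * 2))%:R : R).
Proof.
move=> n1 r0.
have h : expR 1 <= 4 :> R.
  have e2 : expR (1 / 2) <= 2 :> R.
    rewrite -[1 / 2]opprK expRN invf_ple ?posrE ?expR_gt0//.
    by apply: le_trans (expR_ge1Dx _); lra.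
  have -> : expR 1 = expR (1 / 2) * expR (1 / 2) :> R.
    by rewrite -expRD; congr expR; lra.
  apply: (@le_trans _ _ (2 * 2)); last by lra.
  by rewrite ler_pM ?expR_ge0.
have nu4 : (4 <= n * (r * 2))%N by rewrite (@leq_mul 2 2)// leq_pmull.
have nu0 : (0 : R) < (n * (r * 2))%:R.
  by rewrite ltr0n (leq_trans _ nu4).
rewrite -ler_expR lnK ?posrE//; apply: le_trans h _.
by rewrite (ler_nat _ 4).
Qed.

(** 2rn <= n^(2r+1), as 2r <= 2^(2r). *)
Lemma ln_alphabet_le n r : (1 < n)%N -> (0 < r)%N ->
  ln ((n * (r * 2))%:R : R) <= (r.*2.+1)%:R * ln n%:R.
Proof.
move=> n1 r0; have n0 : (0 < n)%N by exact: ltnW.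
have nR : (0 : R) < n%:R by rewrite ltr0n.
rewrite mulr_natl -lnXn// ler_ln ?posrE ?exprn_gt0//; last first.
  by rewrite ltr0n !muln_gt0 n0 r0.
rewrite -natrX ler_nat expnS leq_mul2l; apply/orP; right.
rewrite muln2; apply: (@leq_trans (2 ^ r.*2)%N); first by rewrite ltnW// ltn_expl.
by rewrite leq_exp2r// double_gt0.
Qed.

Lemma block_length_le n r m : (0 < n)%N -> (0 < r)%N ->
  (m ^ r * (n * (r * 2)) <= (n * (r * 2)) ^ r)%N ->
  m%:R <= (r * 2)%:R * n%:R `^ (1 - r%:R^-1) :> R.
Proof.
move=> n0 r0 mnu; set nu := (n * (r * 2))%N in mnu.
have nu0 : (0 < nu)%N by rewrite !muln_gt0 n0 r0.
have rR : (0 : R) < r%:R by rewrite ltr0n.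
have rV1 : r%:R^-1 <= 1 :> R by rewrite invf_le1// ler1n.
have mr : (m ^ r <= nu ^ r.-1)%N.
  by move: mnu; rewrite -{2}(prednK r0) expnSr leq_mul2r eqn0Ngt nu0.
have -> : m%:R = (m%:R ^+ r) `^ r%:R^-1 :> R.
  by rewrite -powR_mulrn// -powRrM divff ?gt_eqF// powRr1.
apply: (@le_trans _ _ ((nu%:R ^+ r.-1) `^ r%:R^-1)).
  rewrite ge0_ler_powR ?nnegrE ?exprn_ge0 ?invr_ge0//.
  by rewrite -!natrX ler_nat.
rewrite -powR_mulrn// -powRrM (_ : r.-1%:R / r%:R = 1 - r%:R^-1 :> R); last first.
  rewrite -subn1 natrB// mulrBl divff ?gt_eqF// mul1r.
  by [].
rewrite /nu natrM mulrC powRM// ler_wpM2r ?powR_ge0//.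
apply: ler1_powR; first by rewrite ler1n muln_gt0 r0.
by rewrite gerBl invr_ge0.
Qed.

Lemma alphabet_block_ratio (nu r m : nat) : (0 < m)%N -> (0 < nu)%N ->
  (nu ^ r <= (2 * m) ^ r * nu)%N ->
  nu%:R ^+ (r * m) / (m%:R * nu%:R ^+ m.-1) ^+ r <= 2 ^+ r * nu%:R :> R.
Proof.
move=> m0 nu0 h.
have nuR : (0 : R) < nu%:R by rewrite ltr0n.
have mR : (0 : R) < m%:R by rewrite ltr0n.
rewrite ler_pdivrMr ?exprn_gt0 ?mulr_gt0 ?exprn_gt0//.
have -> : nu%:R ^+ (r * m) = nu%:R ^+ r * (nu%:R ^+ m.-1) ^+ r :> R.
  by rewrite -exprM -exprD mulnC -mulSn prednK.
rewrite [(m%:R * _) ^+ r]exprMn mulrA ler_wpM2r ?exprn_ge0//.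
rewrite mulrAC -exprMn.
by rewrite -[2]/(2%:R) -natrM -!natrX -natrM ler_nat.
Qed.

End parameters.

Theorem theorem1p1 (R : realType) (d : nat) (hd : (0 < d)%N) :
  exists C : R, 0 < C /\
    forall (n k t : nat) (psi : 'I_k -> mpoly.mpoly n R),
      (1 < n)%N ->
      (forall i : 'I_k,
         [/\ multilinear (psi i), zero_one_coeffs (psi i),
             degree_le d (psi i) & has_multiplicity t (psi i)]) ->
      (gaussian_width (poly_map psi @` boolean_cube R n)
       <= (C * (n%:R * t%:R *
            Num.sqrt (k%:R * n%:R `^ (1 - (uphalf d)%:R^-1) * ln n%:R)))%:E)%E.
Proof.
set r := uphalf d.
have r0 : (0 < r)%N by rewrite /r; case: (d) hd.
have dr : (d <= r.*2)%N by rewrite -leq_uphalf_double.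
pose D : R := 4 * (r%:R * (r * 2)%:R * r.*2.+1%:R).
pose C0 : R := (2 ^+ r * (r * 2)%:R) * (32 * (1 + r * 2 ^ r)%:R) *
  Num.sqrt D * expR 2.
have D0 : 0 < D by rewrite !mulr_gt0// ltr0n ?muln_gt0 ?r0.
have C00 : 0 < C0.
  rewrite !mulr_gt0 ?exprn_gt0 ?sqrtr_gt0 ?expR_gt0//.
  by rewrite ltr0n muln_gt0 r0.
exists (C0 *+ 2); split; first by rewrite mulrn_wgt0.
move=> n k t psi n1 psiP.
have n0 : (0 < n)%N by exact: ltnW.
case: k psi psiP => [|k] psi psiP.
  rewrite gaussian_width_dim0; last first.
    by exists (poly_map psi 0), 0 => // j; rewrite mxE; left.
  by rewrite lee_fin mulr_ge0 ?mulrn_wge0 ?(ltW C00)// !mulr_ge0// sqrtr_ge0.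
set nu := (n * (r * 2))%N.
have nu0 : (0 < nu)%N by rewrite !muln_gt0 n0 r0.
have [m [m0 mnu num]] := block_length_exists nu0 r0.
have nuR : (0 : R) < nu%:R by rewrite ltr0n.
have lnnu := ln_alphabet_ge1 R n1 r0; rewrite -/nu in lnnu.
pose X : R := r%:R * m%:R * ln nu%:R.
have X1 : 1 <= X.
  rewrite -[1]mulr1 ler_pM// -natrM (ler_nat _ 1) muln_gt0 r0.
  by rewrite m0.
have [h /andP[Xq qX]] := power2_near X1.
set q := (2 ^ h.+1)%N in Xq qX.
have q0 : (0 < q)%N by rewrite expn_gt0.
pose N : R := nu%:R ^+ (r * m).
pose total : R := (m%:R * nu%:R ^+ m.-1) ^+ r.
pose tau : R := 32 * ((1 + r * 2 ^ r) * t)%:R.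
pose s : R := Num.sqrt (k.+1%:R * q%:R).
have total0 : 0 < total by rewrite exprn_gt0// mulr_gt0 ?exprn_gt0 ?ltr0n.
have rho0 : 0 <= N / total by rewrite divr_ge0 ?exprn_ge0// ltW.
have tau0 : 0 <= tau by rewrite mulr_ge0.
have s0 : 0 < s by rewrite sqrtr_gt0 mulr_gt0 ?ltr0n.
(* This is the reason for the choice of q: N^(1/q) is at most e. *)
have Nq : N <= expR q%:R.
  apply: le_trans (_ : expR X <= _); last by rewrite ler_expR.
  by rewrite /X -natrM expRM_natl lnK ?posrE.
pose base := N / total * tau * s * expR 2.
have base0 : 0 <= base by rewrite mulr_ge0 ?expR_ge0// mulr_ge0 ?(ltW s0)// mulr_ge0.
have bound := moment_bound (ltn0Sn k) q0 rho0 tau0 (exprn_ge0 _ (ltW nuR)) Nq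
  (erefl s).
have width : (gaussian_width (poly_map psi @` boolean_cube R n) <=
    (base *+ 2)%:E)%E.
  (* base vanishes when t = 0, whereas Young's inequality needs a > 0. *)
  apply/lee_addgt0Pr => e e0.
  apply: (@le_trans _ _ ((base + e / 2) *+ 2)%:E); last first.
    by rewrite -EFinD lee_fin mulrnDl -[X in _ + X]mulr_natr divfK.
  apply: (@kikuchi_gaussian_width R n k.+1 r m t h psi (base + e / 2)
    (q%:R / s) N total tau) => //.
  - move=> i; have [_ zo dg mu] := psiP i; split => //.
    by rewrite /degree_le (leq_trans dg).
  - by rewrite ltr_wpDl// divr_gt0.
  - by rewrite divr_gt0// ltr0n.
  - rewrite (_ : N / (2 * total) = N / total / 2); last first.
      by rewrite invfM mulrA mulrAC.
    apply: le_trans bound _.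
    by rewrite lerXn2r ?nnegrE// ?addr_ge0 ?divr_ge0 ?lerDl ?divr_ge0// ltW.
apply: le_trans width _; rewrite lee_fin -(mulr_natr base) -(mulr_natr C0).
rewrite [leRHS]mulrAC ler_wpM2r//.
have lnn : 0 <= ln (n%:R : R) by rewrite ln_ge0// ler1n.
have sD : s <= Num.sqrt D *
    Num.sqrt (k.+1%:R * n%:R `^ (1 - r%:R^-1) * ln n%:R).
  rewrite /s -(sqrtrM _ (ltW D0)); apply: ler_wsqrtr.
  rewrite -[X in D * X]mulrA mulrCA ler_wpM2l//.
  apply: le_trans qX _; rewrite /D -!mulrA ler_wpM2l//.
  have := ln_alphabet_le R n1 r0; have := block_length_le R n0 r0 mnu.
  rewrite -/nu => mle lnle; rewrite /X -mulrA ler_wpM2l//.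
  apply: (@le_trans _ _ (((r * 2)%:R * n%:R `^ (1 - r%:R^-1)) *
    (r.*2.+1%:R * ln n%:R))).
    by rewrite ler_pM// (le_trans ler01).
  rewrite le_eqVlt; apply/orP; left; apply/eqP; ring.
have ratio := alphabet_block_ratio R m0 nu0 num.
rewrite -/N -/total in ratio.
apply: (@le_trans _ _ ((2 ^+ r * nu%:R) * tau *
  (Num.sqrt D * Num.sqrt (k.+1%:R * n%:R `^ (1 - r%:R^-1) * ln n%:R)) * expR 2)).
  rewrite /base; apply: ler_wpM2r; first exact: expR_ge0.
  apply: ler_pM sD; [exact: mulr_ge0|exact: ltW|exact: ler_wpM2r].
rewrite le_eqVlt /C0 /tau /nu !natrM; apply/orP; left; apply/eqP; ring.
Qed.
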